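(* Let $p$ and $q$ be monic real-rooted polynomials of degree $d$. Then the function $t\mapsto\mathrm{Dis}(q_t\boxplus_d p)$ is nonincreasing for $t<0$ and nondecreasing for $t>0$. In particular, it has a global minimum at $t=0$. For every real-rooted polynomial $q$ of degree $d$ not equal to $(x-c)^d$ (for $c\in\mathbb{R}$), $\mathrm{Dis}(q_t\boxplus_d p)$ is in fact decreasing for $t$ close to zero and $t<0$, and increasing for $t$ close to zero and $t>0$. In particular (for $t=1$), $$\mathrm{Dis}(q\boxplus_d p)>\mathrm{Dis}(p),\qquad\text{or}\qquad H(q\boxplus_d p)>H(p).$$
   Context: For a monic polynomial $p(x)=\prod_{i=1}^d(x-\lambda_i)$ of degree $d$: the discriminant is $\mathrm{Dis}(p)=\prod_{i<j}(\lambda_i-\lambda_j)^2$, and the entropy is $$H(p)=\frac{\log \mathrm{Dis}(p)}{d(d-1)}=\frac{1}{\binom d2}\sum_{i<j}\log|\lambda_i-\lambda_j|,$$ with $H(p)=-\infty$ when $p$ has a multiple root. A polynomial is real-rooted if all its roots are real. For $p=\prod_{i=1}^d(x-\lambda_i)$ and $q=\prod_{i=1}^d(x-\mu_i)$, the finite free additive convolution is $$p\boxplus_d q(x)=\frac1{d!}\sum_{\pi\in\Sigma_d}\prod_{i=1}^d(x-\lambda_i-\mu_{\pi(i)}),$$ where $\Sigma_d$ is the group of permutations of $\{1,\dots,d\}$. It is known that $p\boxplus_d q$ is real-rooted when $p$ and $q$ are. For $q(x)=\prod_{i=1}^d(x-\mu_i)$ and $t\in\mathbb{R}$, the root-dilation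 is $q_t(x)=\prod_{i=1}^d(x-t\mu_i)$, so $q_0(x)=x^d$ and $q_1=q$.
   Formalization: In the strict part it is also assumed that t ↦ Dis(q_t ⊞_d p) is not identically zero; otherwise the strict claims fail, e.g. for p = x^3, q = x^2(x−1), where Dis(q_t ⊞_3 p) = 0 for all t. *)

(* Defs.v *)
From HB Require Import structures.
From mathcomp Require Import all_boot all_order all_algebra all_fingroup.
From mathcomp Require Import complex.
From mathcomp Require Import all_classical all_reals all_analysis.

Set Implicit Arguments.
Unset Strict Implicit.
Unset Printing Implicit Defensive.

Import Order.TTheory GRing.Theory Num.Theory.

Local Open Scope ring_scope.
Local Open Scope complex_scope.

Section FiniteFreeConvolution.
Variable R : realType.
Implicit Types p q : {poly R[i]}.

(* The complex roots of p listed with multiplicity, in an arbitrary order: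
   [p = lead_coef p *: \prod_(z <- roots p) ('X - z%:P)].  The definitions
   below do not depend on the order. *)
Definition roots p : seq R[i] := sval (closed_field_poly_normal p).

Definition real_rooted p : Prop := forall z, root p z -> z \is Num.real.

Definition Dis p : R[i] :=
  \prod_(j < size (roots p)) \prod_(i < j) ((roots p)`_i - (roots p)`_j) ^+ 2.

(* [ComplexField.Normc.normc] is the modulus with values in R, whereas `|z| is
   an element of R[i]. *)
Definition entropy p : \bar R :=
  if uniq (roots p) then
    (('C(size (roots p), 2)%:R)^-1 *
      \sum_(j < size (roots p)) \sum_(i < j)
        ln (ComplexField.Normc.normc ((roots p)`_i - (roots p)`_j)))%:E
  else -oo%E.

(* Meant for p and q of degree d. *)
Definition ffconv (d : nat) p q : {poly R[i]} :=
  (d`!%:R)^-1 *: \sum_(s : 'S_d) \prod_(i < d)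
    ('X - ((roots p)`_i + (roots q)`_(s i))%:P).

Definition root_dilation (t : R) q : {poly R[i]} :=
  \prod_(z <- roots q) ('X - (t%:C * z)%:P).

End FiniteFreeConvolution.

(* Main.v *)
Require Import Defs.
From mathcomp Require Import all_boot all_order all_algebra all_fingroup.
From mathcomp Require Import complex.
From mathcomp Require Import all_classical all_reals all_analysis.
From mathcomp Require polyrcf.
From mathcomp Require Import ring.

(** Write m_i and l_i for the roots of q and p, and r_t for the convolution
    q_t [+]_d p, that is
    r_t(x) = 1/d! sum_s prod_i (x - t m_i - l_(s i)), and h = dr_t/dt.
    When r_t has simple roots, its discriminant is up to sign and a power of d
    the product of the critical values r_t(nu), r_t'(nu) = 0.  By the envelope
    principle the logarithmic derivative of the discriminant in t is therefore
    sum_nu h(nu) / r_t(nu).  The theorem holds because every term is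
    nonnegative when t > 0: each critical value moves away from 0.

    To see the sign, note that r' - i h has no zero in the open upper half
    plane.  Indeed convolution with p is an iterated polar derivative
    [polarize], with poles shifted by the real numbers l_k; the two polynomials
    r' and h are the images of q_t' and dq_t/dt, and q_t' - i dq_t/dt is itself,
    up to a scalar, the polar derivative of q_t with pole i t.  Laguerre's
    theorem [laguerre] says that polar derivatives with poles above a line do
    not create zeros above that line ([conv_diff_no_root]).  The
    Hermite-Biehler argument [hermite_biehler_sign] then gives
    r''(nu) h(nu) <= 0 at the (real) critical points, while real-rootedness
    gives r''(nu) r(nu) < 0 ([newton_strict]).  Hence h(nu) / r(nu) >= 0.

    The derivative formula [resm_deriv_dlog] is algebraic: the discriminant is
    a polynomial in t, namely up to sign the determinant of r_t'(M) with M the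
    companion matrix of r_t.  The two occurrences of t are differentiated separately.
    Varying only the companion matrix gives the sum over critical points,
    varying only r_t' gives sum_i h'(g_i) / r'(g_i) over the roots g_i, which is
    0 by Lagrange interpolation because h' has degree at most d - 2.

    A nonnegative real polynomial whose derivative is nonnegative for t > 0
    wherever it does not vanish is nondecreasing on t >= 0, and strictly
    increasing unless it is constant ([poly_mono], [poly_smono]).  If the
    discriminant were a nonzero constant, h would vanish at all critical points
    for every t > 0, so h = -c r' with c the mean of the m_i; letting t grow
    after the rescaling x = t y leaves sum_i (m_i - c) prod_(j != i) (y - m_j)
    = 0, which forces all m_i to be equal ([conv_diff_eq0]).  Negative t reduce
    to positive t by negating the m_i. *)

Set Implicit Arguments.
Unset Strict Implicit.
Unset Printing Implicit Defensive.

Import Order.TTheory GRing.Theory Num.Theory.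
Local Open Scope ring_scope.
Local Open Scope complex_scope.

(** * Sums over permutations and polar derivatives *)

Lemma lift_perm_surj n (i j : 'I_n.+1) (s : 'S_n.+1) :
  s i = j -> {s' : 'S_n | s = lift_perm i j s'}.
Proof.
move=> sij.
have sK k : {k' | s (lift i k) = lift j k'}.
  have := neq_lift i k; rewrite -(inj_eq (@perm_inj _ s)) sij => jk.
  by case: (unlift_some jk) => k' ->; exists k'.
have inj_f : injective (fun k => sval (sK k)).
  move=> k1 k2 /(congr1 (lift j)).
  by rewrite -!(svalP (sK _)) => /perm_inj /lift_inj.
exists (perm inj_f); apply/permP => k.
case: (unliftP i k) => [k'|] ->; last by rewrite lift_perm_id.
by rewrite lift_perm_lift permE -(svalP (sK k')).
Qed.

(** Expansion of a permanent along its column 0.  It matches the recursion of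
    iterated polar derivatives, which remove one root per step. *)
Lemma sum_perm_expand (A : comPzRingType) n (a : 'I_n.+1 -> 'I_n.+1 -> A) :
  \sum_(s : 'S_n.+1) \prod_i a i (s i) =
  \sum_j a j ord0 *
    \sum_(s : 'S_n) \prod_i a (lift j i) (lift ord0 (s i)).
Proof.
rewrite (partition_big (fun s : 'S_n.+1 => (s^-1)%g ord0) predT) //=.
apply: eq_bigr => j _; rewrite big_distrr /=.
rewrite (reindex (lift_perm j ord0)) /=; last first.
  exists (fun s : 'S_n.+1 => if s j =P ord0 is ReflectT e
                   then sval (@lift_perm_surj n j ord0 s e) else 1%g) => s.
    case: eqP => [e _|]; last by rewrite lift_perm_id.
    case: lift_perm_surj => s' /= /permP es; apply/permP => k.
    have := es (lift j k); rewrite !lift_perm_lift => /lift_inj ->.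
    done.
  rewrite inE => /eqP e; case: eqP => [e'|[]]; first by case: lift_perm_surj.
  by rewrite -e permKV.
apply: eq_big => [s|s _].
  by rewrite -(inj_eq (@perm_inj _ (lift_perm j ord0 s))) permKV lift_perm_id eqxx.
rewrite (bigD1_ord j) //= lift_perm_id; congr (_ * _).
by apply: eq_bigr => i _; rewrite lift_perm_lift.
Qed.

Section Polar.
Variable A : comNzRingType.
Implicit Types (z : A) (f g : {poly A}) (zs : seq A).

(** The polar derivative with pole z of a form of degree n; it lowers the
    degree bound n by one, and tends to the derivative as z goes to infinity
    (after division by z). *)
Definition polar (n : nat) z f : {poly A} := f *+ n + (z%:P - 'X) * f^`().

(** The symmetric multi-affine form attached to f, regarded as a polynomial of
    degree the length of zs and multiplied by the factorial of that length.
    Only the constant polynomial left after all polar derivatives matters, so it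
    is read off at 0. *)
Fixpoint polarize zs f : A :=
  if zs is z :: zs' then polarize zs' (polar (size zs) z f) else f.[0].

Lemma polarD n z f g : polar n z (f + g) = polar n z f + polar n z g.
Proof. by rewrite /polar derivD mulrnDl mulrDr addrACA. Qed.

Lemma polarZ n z c f : polar n z (c *: f) = c *: polar n z f.
Proof. by rewrite /polar derivZ scalerDr scalerMnr scalerAr. Qed.

Lemma polarizeD zs f g : polarize zs (f + g) = polarize zs f + polarize zs g.
Proof.
elim: zs f g => [|z zs IH] f g /=; first by rewrite hornerD.
by rewrite polarD IH.
Qed.

Lemma polarizeZ zs c f : polarize zs (c *: f) = c * polarize zs f.
Proof.
elim: zs f => [|z zs IH] f /=; first by rewrite hornerZ.
by rewrite polarZ IH.
Qed.

Lemma polarize0 zs : polarize zs 0 = 0.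
Proof. by rewrite -(scale0r 0) polarizeZ mul0r. Qed.

Lemma polarize_sum zs (I : finType) (F : I -> {poly A}) :
  polarize zs (\sum_i F i) = \sum_i polarize zs (F i).
Proof. exact: (big_morph _ (polarizeD zs) (polarize0 zs)). Qed.

Lemma deriv_sum (I : finType) (F : I -> {poly A}) :
  (\sum_i F i)^`() = \sum_i (F i)^`().
Proof. by rewrite raddf_sum. Qed.

Lemma deriv_prod_ord n (F : 'I_n -> {poly A}) :
  (\prod_i F i)^`() = \sum_i (F i)^`() * \prod_(j | j != i) F j.
Proof.
elim: n F => [|n IH] F; first by rewrite !big_ord0 derivC.
rewrite !big_ord_recl derivM IH /=; congr (_ * _ + _).
  by rewrite [RHS]big_mkcond big_ord_recl /= mul1r; apply: eq_bigr.
rewrite mulr_sumr; apply: eq_bigr => i _; rewrite mulrCA; congr (_ * _).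
rewrite [RHS]big_mkcond big_ord_recl /=; congr (_ * _).
rewrite [LHS]big_mkcond; apply: eq_bigr => j _.
by rewrite (inj_eq (@lift_inj _ _)).
Qed.

Lemma deriv_prodXsubC n (a : 'I_n -> A) :
  (\prod_i ('X - (a i)%:P))^`() = \sum_i \prod_(j | j != i) ('X - (a j)%:P).
Proof.
rewrite deriv_prod_ord; apply: eq_bigr => i _.
by rewrite derivXsubC mul1r.
Qed.

Lemma deriv_at_root n (g : 'I_n -> A) i :
  (\prod_j ('X - (g j)%:P))^`().[g i] = \prod_(j | j != i) (g i - g j).
Proof.
rewrite deriv_prodXsubC horner_sum (bigD1 i) //=.
rewrite [X in _ + X]big1 ?addr0 => [|j ji].
  by rewrite horner_prod; apply: eq_bigr => j _; rewrite hornerXsubC.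
by rewrite horner_prod (bigD1 i) 1?eq_sym //= hornerXsubC subrr mul0r.
Qed.

Lemma prod_neq_lift n (i : 'I_n.+1) (F : 'I_n.+1 -> {poly A}) :
  \prod_(j | j != i) F j = \prod_j F (lift i j).
Proof.
rewrite big_mkcond (bigD1_ord i) //= eqxx mul1r; apply: eq_bigr => j _.
by rewrite eq_sym neq_lift.
Qed.

Lemma polar_prod n z (a : 'I_n -> A) :
  polar n z (\prod_i ('X - (a i)%:P)) =
  \sum_i (z - a i) *: \prod_(j | j != i) ('X - (a j)%:P).
Proof.
rewrite /polar deriv_prodXsubC mulr_sumr.
rewrite -[X in _ *+ X]card_ord -sumr_const -big_split /=; apply: eq_bigr => i _.
rewrite (bigD1 i) //= -mulrDl -mul_polyC rmorphB /=; congr (_ * _); ring.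
Qed.

(** Each polar derivative sums over the root that is deleted, so iterating
    expands the permanent of the matrix of entries z_k - a_i. *)
Lemma polarize_prod zs n (a : 'I_n -> A) : size zs = n ->
  polarize zs (\prod_i ('X - (a i)%:P)) =
  \sum_(s : 'S_n) \prod_i (zs`_(s i) - a i).
Proof.
elim: zs n a => [|z zs IH] [|n] a //= => [_|[szs]].
  rewrite big_ord0 hornerC (big_pred1 1%g) ?big_ord0 // => s.
  by apply/esym/eqP/permP => -[].
rewrite szs polar_prod polarize_sum.
rewrite (sum_perm_expand (fun i j => (z :: zs)`_j - a i)); apply: eq_bigr => i _.
rewrite polarizeZ; congr (_ * _) => /=.
by rewrite prod_neq_lift IH.
Qed.

(** The version with one root missing: the product over j != i is the difference
    of two full products, in which only the i-th root differs, by 1. *)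
Lemma polarize_prod_neq zs n (a : 'I_n -> A) i : size zs = n ->
  polarize zs (\prod_(j | j != i) ('X - (a j)%:P)) =
  \sum_(s : 'S_n) \prod_(j | j != i) (zs`_(s j) - a j).
Proof.
move=> szs; pose b j := if j == i then a i - 1 else a j.
have -> : \prod_(j | j != i) ('X - (a j)%:P) =
    \prod_j ('X - (b j)%:P) + -1 *: \prod_j ('X - (a j)%:P).
  rewrite [in RHS](bigD1 i) // [X in _ = _ + _ *: X](bigD1 i) //= /b eqxx.
  rewrite [X in _ = _ * X + _](eq_bigr (fun j => 'X - (a j)%:P)) => [|j /negPf-> //].
  by rewrite -mul_polyC !rmorphB /= rmorphN !rmorph1; ring.
rewrite polarizeD polarizeZ !polarize_prod // mulN1r -sumrB.
apply: eq_bigr => s _; rewrite (bigD1 i) // [X in _ - X](bigD1 i) //= /b eqxx.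
rewrite [X in _ * X - _](eq_bigr (fun j => zs`_(s j) - a j)) => [|j /negPf-> //].
by ring.
Qed.

End Polar.

(** * Resultants with a monic polynomial and their first variation *)

Section Resultant.
Variables (A : comNzRingType) (n : nat).
Implicit Types (r f : {poly A}).

(** The companion matrix of r in the fixed dimension n + 1, defined for every r
    so that it commutes with ring morphisms without transport of dimensions. *)
Definition compmx r : 'M[A]_n.+1 :=
  \matrix_(i, j) (if i == n :> nat then - r`_j else (i.+1 == j :> nat)%:R).

(** The resultant of f with a monic r of degree n + 1, as the norm of f modulo
    r. *)
Definition resm r f : A := \det (horner_mx (compmx r) f).

Lemma char_poly_compmx r : r \is monic -> size r = n.+2 ->
  char_poly (compmx r) = r.
Proof.
move=> mr sr; rewrite -[RHS](companionmxK mr).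
by rewrite /companionmx /compmx sr.
Qed.

(** The determinant is multiplicative and det (M - z) is, up to sign, the
    characteristic polynomial r at z: this is how critical values of r enter. *)
Lemma resm_split r c (s : seq A) : r \is monic -> size r = n.+2 ->
  resm r (c *: \prod_(z <- s) ('X - z%:P)) =
  c ^+ n.+1 * \prod_(z <- s) ((-1) ^+ n.+1 * r.[z]).
Proof.
move=> mr sr; rewrite /resm linearZ /= detZ rmorph_prod; congr (_ * _).
rewrite (big_morph _ (@det_mulmx _ _) (@det1 _ _)); apply: eq_bigr => z _.
rewrite -{2}(char_poly_compmx mr sr) /char_poly -horner_evalE -det_map_mx.
rewrite -detZ; congr (\det _); rewrite rmorphB /= horner_mx_X horner_mx_C.
apply/matrixP => i j; rewrite !mxE /= horner_evalE hornerD hornerN hornerC.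
by rewrite hornerMn hornerX; ring.
Qed.

End Resultant.

Lemma resm_map (A B : comNzRingType) (phi : {rmorphism A -> B}) n
    (r f : {poly A}) :
  phi (resm n r f) = resm n (map_poly phi r) (map_poly phi f).
Proof.
rewrite /resm -det_map_mx map_horner_mx; congr (\det (horner_mx _ _)).
apply/matrixP => i j; rewrite !mxE; case: ifP => _; last by rewrite rmorph_nat.
by rewrite rmorphN coef_map.
Qed.

Lemma size_prod_ord_XsubC (A : nzRingType) n (a : 'I_n -> A) :
  size (\prod_i ('X - (a i)%:P)) = n.+1.
Proof. by rewrite size_prod_XsubC /index_enum -enumT size_enum_ord. Qed.

(** Over an algebraically closed field f splits as well, which turns the previous
    formula into a double product over both sets of roots. *)
Lemma resm_roots (K : closedFieldType) n (g : 'I_n.+1 -> K) (f : {poly K}) :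
  resm n (\prod_i ('X - (g i)%:P)) f = \prod_i f.[g i].
Proof.
have [s ->] := closed_field_poly_normal f; set c := lead_coef f.
rewrite resm_split ?monic_prod_XsubC //; last first.
  by rewrite size_prod_XsubC /index_enum -enumT size_enum_ord.
under [RHS]eq_bigr do rewrite hornerZ horner_prod.
rewrite [RHS]big_split /= prodr_const card_ord; congr (_ * _).
rewrite exchange_big /=; apply: eq_bigr => z _.
rewrite horner_prod -[X in _ ^+ X]card_ord -prodr_const -big_split /=.
by apply: eq_bigr => i _; rewrite !hornerXsubC; ring.
Qed.

(** The sum of the residues of f / prod_i (X - g_i).  It is the coefficient of
    degree n of the Lagrange interpolation of f at the g_i, and f has degree less
    than n. *)
Lemma sum_residues (K : fieldType) n (g : 'I_n.+1 -> K) (f : {poly K}) :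
  injective g -> (size f <= n)%N ->
  \sum_i f.[g i] / (\prod_(j | j != i) (g i - g j)) = 0.
Proof.
move=> g_inj sf; pose w i := \prod_(j | j != i) (g i - g j).
have w0 i : w i != 0.
  by apply/prodf_neq0 => j ji; rewrite subr_eq0 (inj_eq g_inj) eq_sym.
pose L i := \prod_(j | j != i) ('X - (g j)%:P).
have sL i : size (L i) = n.+1.
  by rewrite /L prod_neq_lift size_prod_ord_XsubC.
pose e := \sum_i (f.[g i] / w i) *: L i - f.
have e0 : e = 0.
  apply: (@roots_geq_poly_eq0 _ _ (codom g)).
  - apply/allP => _ /codomP[i ->]; rewrite /root hornerD hornerN horner_sum.
    rewrite (bigD1 i) //= big1 => [|j ji].
      rewrite hornerZ horner_prod addr0.
      under eq_bigr do rewrite hornerXsubC.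
      by rewrite divfK ?subrr.
    rewrite hornerZ horner_prod (bigD1 i) 1?eq_sym //= hornerXsubC subrr.
    by rewrite mul0r mulr0.
  - by rewrite map_inj_uniq ?enum_uniq.
  rewrite size_codom card_ord; apply: leq_trans (size_polyD _ _) _.
  rewrite geq_max size_polyN (leq_trans sf) // andbT.
  apply: leq_trans (size_sum _ _ _) _; apply/bigmax_leqP => i _.
  by rewrite -(sL i) size_scale_leq.
have := congr1 (fun p : {poly K} => p`_n) e0.
rewrite coef0 coefD coefN (nth_default 0 sf) subr0 coef_sum => e1.
rewrite -[RHS]e1.
apply: eq_bigr => i _; rewrite coefZ -{1}[f.[_] / _]mulr1; congr (_ * _).
have : L i \is monic by apply: monic_prod => j _; exact: monicXsubC.
by rewrite monicE lead_coefE sL /= => /eqP ->.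
Qed.

Lemma poly_eq0_seq (K : idomainType) (P : {poly K}) (u : nat -> K) :
  injective u -> (forall k, P.[u k] = 0) -> P = 0.
Proof.
move=> u_inj Pu.
apply: (@roots_geq_poly_eq0 _ _ [seq u i | i <- iota 0 (size P)]).
- by apply/allP => _ /mapP[i _ ->]; rewrite /root Pu.
- by rewrite map_inj_uniq ?iota_uniq.
by rewrite size_map size_iota.
Qed.

(** Polynomials F in X whose coefficients are polynomials in a parameter t are
    elements of {poly {poly K}}; [eval_coef] fixes the parameter and [deriv_coef]
    is the partial derivative in the parameter. *)
Section FirstOrder.
Variable K : numClosedFieldType.
Implicit Types (F : {poly {poly K}}) (t : K).

Definition eval_coef t F : {poly K} := map_poly (horner_eval t) F.
Definition deriv_coef t F : {poly K} :=
  map_poly (horner_eval t) (map_poly (@deriv K) F).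

Lemma poly_fun_inj (f g : {poly K}) : (forall x, f.[x] = g.[x]) -> f = g.
Proof.
move=> fg; apply/eqP; rewrite -subr_eq0; apply/eqP.
apply: (poly_eq0_seq (u := fun k => k%:R)) => [i j /eqP|k].
  by rewrite eqr_nat => /eqP.
by rewrite hornerD hornerN fg subrr.
Qed.

Lemma horner_eval_coef t F (g : {poly K}) : F.[g].[t] = (eval_coef t F).[g.[t]].
Proof. by rewrite /eval_coef -[LHS]/(horner_eval t _) -horner_map. Qed.

Lemma horner_deriv_coef t F x : (deriv_coef t F).[x] = (F.[x%:P])^`().[t].
Proof.
rewrite (horner_coef F) raddf_sum horner_sum /=.
rewrite (@horner_coef_wide _ (size F)); last first.
  by rewrite (leq_trans (size_poly _ _)) ?size_poly.
apply: eq_bigr => i _; rewrite !coef_map /= /horner_eval.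
by rewrite -rmorphXn /= derivM derivC mulr0 addr0 hornerM hornerC.
Qed.

Lemma deriv_eval_coef t F : (eval_coef t F)^`() = eval_coef t F^`().
Proof. exact: deriv_map. Qed.

Lemma deriv_deriv_coef t F : (deriv_coef t F)^`() = deriv_coef t F^`().
Proof.
rewrite /deriv_coef deriv_map; congr map_poly; apply/polyP => i.
by rewrite coef_deriv !coef_map /= coef_deriv derivMn.
Qed.

(** Chain rule on the diagonal of a polynomial in two variables. *)
Lemma deriv_diag F t :
  (F.['X])^`().[t] = (eval_coef t F)^`().[t] + (F.[t%:P])^`().[t].
Proof.
elim/poly_ind: F => [|F c IH].
  by rewrite /eval_coef rmorph0 !horner0 deriv0 horner0 addr0.
rewrite /eval_coef rmorphD rmorphM /= map_polyX map_polyC /= -/(eval_coef t F).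
rewrite !(hornerMXaddC, derivD, derivM, derivX, derivC).
rewrite !(hornerD, hornerM, hornerX, hornerC).
by rewrite IH !horner_eval_coef hornerX hornerC; ring.
Qed.

Lemma dlog_prod n (f : 'I_n -> {poly K}) t : (forall i, (f i).[t] != 0) ->
  (\prod_i f i)^`().[t] = (\prod_i f i).[t] * \sum_i (f i)^`().[t] / (f i).[t].
Proof.
move=> f0; rewrite deriv_prod_ord horner_sum mulr_sumr; apply: eq_bigr => i _.
rewrite [in RHS](bigD1 i) //= !hornerM; field; exact: f0.
Qed.

(** The parameter occurs in F and in F^`(); the two occurrences are separated as
    the two variables of P, and [deriv_diag] adds up the partial derivatives.
    With F^`() held fixed, [resm_split] gives a product over the critical points nu_k;
    with F held fixed, [resm_roots] gives a product over the roots g_i, whose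
    logarithmic derivative is a vanishing sum of residues. *)
Lemma resm_deriv_dlog n F t (g : 'I_n.+1 -> K) (nu : 'I_n -> K) :
    F \is monic -> size F = n.+2 -> injective g ->
    eval_coef t F = \prod_i ('X - (g i)%:P) ->
    (eval_coef t F)^`() = n.+1%:R *: \prod_k ('X - (nu k)%:P) ->
    (forall k, (eval_coef t F).[nu k] != 0) ->
  (resm n F F^`())^`().[t] =
  (resm n F F^`()).[t] * \sum_k (deriv_coef t F).[nu k] / (eval_coef t F).[nu k].
Proof.
move=> mF sF g_inj Fg Fnu Fnu0.
pose P : {poly {poly K}} :=
  resm n (map_poly polyC F) (map_poly (map_poly polyC) F^`()).
have P_diag : P.['X] = resm n F F^`().
  rewrite -horner_evalE resm_map -!map_poly_comp.
  congr (resm _ _ _); apply: map_poly_id => c _ /=.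
    by rewrite horner_evalE hornerC.
  by rewrite horner_evalE -/(comp_poly 'X c) comp_polyXr.
have P_out x : (eval_coef t P).[x] = \prod_i (eval_coef x F^`()).[g i].
  rewrite -resm_roots -Fg -horner_evalE /eval_coef !resm_map -!map_poly_comp.
  congr (resm _ _ _); apply: eq_map_poly => c /=.
    by rewrite map_polyC /= !horner_evalE hornerC.
  by rewrite -map_poly_comp map_poly_id // => a _ /=; rewrite horner_evalE hornerC.
have P_in : P.[t%:P] = (n.+1%:R%:P) ^+ n.+1 *
    \prod_k ((-1) ^+ n.+1 * F.[(nu k)%:P]).
  pose s := [seq (nu k)%:P | k <- enum 'I_n].
  have <- : resm n F (n.+1%:R%:P *: \prod_(z <- s) ('X - z%:P)) =
      (n.+1%:R%:P) ^+ n.+1 * \prod_k ((-1) ^+ n.+1 * F.[(nu k)%:P]).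
    by rewrite resm_split // big_map big_enum.
  rewrite -horner_evalE resm_map -!map_poly_comp; congr (resm _ _ _).
    by apply: map_poly_id => c _ /=; rewrite horner_evalE hornerC.
  transitivity (map_poly polyC (eval_coef t F)^`()).
    rewrite deriv_eval_coef /eval_coef -map_poly_comp; apply: eq_map_poly => c /=.
    by rewrite !horner_evalE -{2}[t]hornerX horner_map /= hornerX.
  rewrite Fnu map_polyZ /= rmorph_prod /= big_map big_enum /=.
  by congr (_ *: _); apply: eq_bigr => k _; rewrite rmorphB /= map_polyX map_polyC.
have P_outE : eval_coef t P = \prod_i F^`().[(g i)%:P].
  apply: poly_fun_inj => x; rewrite P_out (@horner_prod K); apply: eq_bigr => i _.
  by rewrite horner_eval_coef hornerC.
have E_out : (resm n F F^`()).[t] = (\prod_i F^`().[(g i)%:P]).[t].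
  by rewrite -P_outE -P_diag horner_eval_coef hornerX.
have E_in : (resm n F F^`()).[t] = P.[t%:P].[t].
  by rewrite -P_diag !horner_eval_coef hornerX hornerC.
have Fg' i : (eval_coef t F^`()).[g i] = \prod_(j | j != i) (g i - g j).
  by rewrite -deriv_eval_coef Fg deriv_at_root.
have Fg'0 i : (eval_coef t F^`()).[g i] != 0.
  rewrite Fg'; apply/prodf_neq0 => j ji.
  by rewrite subr_eq0 (inj_eq g_inj) eq_sym.
rewrite -P_diag deriv_diag P_outE dlog_prod; last first.
  by move=> i; rewrite horner_eval_coef hornerC.
(* The variation of F^`() alone contributes nothing: since F is monic, the
   derivative in t has degree at most n, hence its derivative in X degree at most
   n - 1. *)
rewrite -E_out [X in _ * X + _](_ : _ = 0) ?mulr0 ?add0r; last first.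
  rewrite -[RHS](sum_residues (f := (deriv_coef t F)^`()) g_inj).
    apply: eq_bigr => i _; rewrite -Fg' horner_eval_coef hornerC; congr (_ / _).
    by rewrite deriv_deriv_coef horner_deriv_coef.
  have sh : (size (deriv_coef t F) <= n.+1)%N.
    apply/leq_sizeP => j; rewrite leq_eqVlt => /predU1P[<-|nj].
      rewrite !coef_map /=; have := mF; rewrite monicE lead_coefE sF /= => /eqP ->.
      by rewrite derivC horner_evalE horner0.
    by rewrite !coef_map /= nth_default ?sF // deriv0 horner_evalE horner0.
  apply: leq_trans (size_poly _ _) _.
  by rewrite -[n]/(n.+1.-1) -!subn1 leq_sub2r.
rewrite P_diag E_in P_in derivM -rmorphXn /= derivC mul0r add0r hornerM.
rewrite dlog_prod => [|k]; last first.
  rewrite hornerM mulf_neq0 ?horner_eval_coef ?hornerC //.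
  by rewrite -polyCN -rmorphXn /= hornerC signr_eq0.
rewrite hornerM mulrA; congr (_ * _); apply: eq_bigr => k _.
rewrite -polyCN -rmorphXn /= derivM derivC mul0r add0r !hornerM hornerC.
rewrite horner_deriv_coef horner_eval_coef hornerC -mulf_div divff ?signr_eq0 //.
by rewrite mul1r.
Qed.
End FirstOrder.

(** * Zeros in half planes *)

Section UpperHalfPlane.
Variable R : rcfType.
Local Notation C := R[i].
Local Notation Re := (@complex.Re R).
Local Notation Im := (@complex.Im R).
Implicit Types (f g : {poly C}) (x z w : C) (s : seq C).

Lemma ImD x z : Im (x + z) = Im x + Im z. Proof. by case: x z => [? ?] []. Qed.
Lemma ImN x : Im (- x) = - Im x. Proof. by case: x. Qed.
Lemma ImV x : Im x^-1 = - Im x / (Re x ^+ 2 + Im x ^+ 2).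
Proof. by case: x => a b /=; rewrite mulNr. Qed.

Lemma Im_real x : x \is Num.real -> Im x = 0.
Proof. by case: x => a b; rewrite complex_real => /eqP. Qed.

(** Inversion: z |-> 1 / z maps the half plane Im z >= B to the disc of radius
    1 / (2 B) centred at - i / (2 B), here scaled by 2 B.  The disc is convex and
    has 0 on its boundary, so it is stable under averages that include the
    inverse of infinity. *)
Lemma disc_halfplane (B : R) z : 0 < B -> z != 0 ->
  (`|(B *+ 2)%:C / z + 'i%C| <= 1) = (B <= Im z).
Proof.
move=> B0 z0.
have -> : (B *+ 2)%:C / z + 'i%C = ((B *+ 2)%:C + 'i%C * z) / z.
  by rewrite mulrDl mulfK.
rewrite normrM normfV ler_pdivrMr ?normr_gt0 // mul1r.
rewrite -ler_sqr ?nnegrE ?normr_ge0 // -!add_Re2_Im2 lecR.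
case: z {z0} => a b /=; rewrite -subr_ge0 -[RHS]subr_ge0.
rewrite -[RHS](pmulr_rge0 _ (mulr_gt0 (ltr0n R 4) B0)).
congr (0 <= _); ring.
Qed.

Definition no_root_above (b : R) f := forall x, b < Im x -> f.[x] != 0.

Lemma dlog_prod_seq s x : all (fun w => x != w) s ->
  (\prod_(w <- s) ('X - w%:P))^`().[x] =
  (\prod_(w <- s) ('X - w%:P)).[x] * \sum_(w <- s) (x - w)^-1.
Proof.
elim: s => [|w s IH] /=; first by rewrite !big_nil derivC horner0 mulr0.
move=> /andP[xw /IH {}IH]; rewrite !big_cons derivM derivXsubC mul1r.
rewrite !hornerE IH; field; by rewrite subr_eq0.
Qed.

(** The condition excludes f = 0, so f has a scalar factor c != 0 and all its
    roots are on or below the line Im = b. *)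
Lemma no_root_above_factor b f : no_root_above b f ->
  exists c s, [/\ f = c *: \prod_(w <- s) ('X - w%:P), c != 0,
    size f = (size s).+1 & all (fun w => Im w <= b) s].
Proof.
move=> fb; have [s fE] := closed_field_poly_normal f.
have f0 : f != 0.
  apply: contraNneq (fb (0 +i* (b + 1)) _) => /= [->|].
    by rewrite horner0.
  by rewrite ltrDl.
exists (lead_coef f), s; rewrite lead_coef_eq0; split => //.
  by rewrite {1}fE size_scale ?lead_coef_eq0 // size_prod_XsubC.
apply/allP => w ws; rewrite leNgt; apply: contraL (ws) => /fb.
rewrite fE hornerZ mulf_eq0 negb_or => /andP[_].
by rewrite -[_ == 0]/(root _ w) root_prod_XsubC.
Qed.

(** If the polar derivative vanishes at x with Im x > b, then x - z is the
    harmonic mean of n numbers: the x - w for the roots w of f, and infinity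
    counted n - deg f times.  These have imaginary part at least B = Im x - b, so
    their inverses lie in the disc of [disc_halfplane], which also contains 0.
    The average of the inverses stays in the disc, so Im (x - z) >= B, that is
    Im z <= b. *)
Lemma laguerre b n z f : no_root_above b f -> (size f <= n.+1)%N -> (0 < n)%N ->
  b < Im z -> no_root_above b (polar n z f).
Proof.
move=> fb sf n0 bz x bx; apply/negP => /eqP; have fx := fb _ bx.
have [c [s [fE c0 sfE /allP sb]]] := no_root_above_factor fb.
have xs : all (fun w => x != w) s.
  by apply/allP => w /sb wb; apply: contraTneq bx => ->; rewrite -leNgt.
rewrite /polar hornerD hornerMn hornerM !hornerE.
have -> : f^`().[x] = f.[x] * \sum_(w <- s) (x - w)^-1.
  by rewrite fE derivZ !hornerZ dlog_prod_seq // mulrA.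
set S := \sum_(w <- s) _ => eq0.
have {eq0} eS : (x - z) * S = n%:R.
  apply: (mulfI fx); rewrite mulr_natr; apply/eqP.
  by rewrite eq_sym -subr_eq0 -eq0; apply/eqP; ring.
have xz : x - z != 0.
  by apply: contraTneq n0 => e; rewrite -leqNgt leqn0 -(eqr_nat C) -eS e mul0r.
pose B := Im x - b; have B0 : 0 < B by rewrite subr_gt0.
have sn : (size s <= n)%N by rewrite -ltnS -sfE.
have : `|(B *+ 2)%:C * S + n%:R * 'i%C| <= n%:R.
  have -> : (B *+ 2)%:C * S + n%:R * 'i%C =
     \sum_(w <- s) ((B *+ 2)%:C / (x - w) + 'i%C) + (n - size s)%:R * 'i%C.
    rewrite big_split /= -mulr_sumr -addrA; congr (_ + _).
    rewrite big_const_seq count_predT iter_addr_0 -['i%C *+ size s]mulr_natl.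
    by rewrite -mulrDl -natrD subnKC.
  apply: le_trans (ler_normD _ _) _.
  rewrite -[X in _ <= X%:R](subnKC sn) natrD lerD //; last first.
    rewrite normrM normr_nat -[X in _ <= X]mulr1 ler_wpM2l ?ler0n //.
    by rewrite normc_def /= expr0n expr1n add0r sqrtr1.
  apply: le_trans (ler_norm_sum _ _ _) _.
  rewrite -sum1_size natr_sum big_seq_cond [X in _ <= X]big_seq_cond.
  apply: ler_sum => w; rewrite andbT => ws.
  rewrite disc_halfplane ?subr_eq0 ?(allP xs) //.
  by rewrite ImD ImN lerB // sb.
have -> : (B *+ 2)%:C * S + n%:R * 'i%C = n%:R * ((B *+ 2)%:C / (x - z) + 'i%C).
  by rewrite -eS; field.
rewrite normrM normr_nat ger_pMr ?ltr0n // disc_halfplane //.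
by rewrite ImD ImN /B lerD2l lerN2 leNgt bz.
Qed.

(** The terms of degree n of n f and X f' cancel. *)
Lemma size_polar n z f : (size f <= n.+1)%N -> (size (polar n z f) <= n)%N.
Proof.
move=> sf; apply/leq_sizeP => j nj.
rewrite /polar coefD coefMn mulrBl coefB coefCM coefXM !coef_deriv.
have -> : f`_j.+1 = 0 by rewrite nth_default // (leq_trans sf).
rewrite mul0rn mulr0 sub0r.
case: j nj => [|j] /= nj.
  by move: nj; rewrite leqn0 => /eqP ->; rewrite mulr0n subr0.
have [->|jn] := eqVneq n j.+1; first by rewrite subrr.
by rewrite (nth_default 0) ?mul0rn ?subr0 // (leq_trans sf) // ltn_neqAle jn.
Qed.

Lemma polarize_neq0 b zs f : no_root_above b f -> (size f <= (size zs).+1)%N ->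
  all (fun z => b < Im z) zs -> polarize zs f != 0.
Proof.
elim: zs f => [|z zs IH] f fb sf /=.
  move=> _; have := fb (0 +i* (b + 1)); rewrite (size1_polyC sf) !hornerC.
  by apply; rewrite /= ltrDl.
move=> /andP[bz bzs]; apply: IH => //; first exact: laguerre.
exact: size_polar.
Qed.

(** f'/f is the sum of the 1 / (x - w), and each x - w has nonnegative imaginary
    part. *)
Lemma Im_dlog_le0 f x : no_root_above 0 f -> Im x = 0 -> f.[x] != 0 ->
  Im (f^`().[x] / f.[x]) <= 0.
Proof.
move=> fb xr fx; have [c [s [fE c0 _ /allP sb]]] := no_root_above_factor fb.
have xs : all (fun w => x != w) s.
  apply/allP => w ws; apply: contraNneq fx => ->.
  by rewrite fE hornerZ mulf_eq0 -[_.[w] == 0]/(root _ w) root_prod_XsubC ws orbT.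
have -> : f^`().[x] / f.[x] = \sum_(w <- s) (x - w)^-1.
  move: fx; rewrite fE derivZ !hornerZ dlog_prod_seq // => fx.
  by rewrite mulrA mulrC mulKf.
rewrite (big_morph _ ImD (erefl : Im 0 = 0)) big_seq; apply: sumr_le0 => w ws.
rewrite ImV ImD ImN xr sub0r opprK mulr_le0_ge0 ?sb //.
by rewrite invr_ge0 addr_ge0 // sqr_ge0.
Qed.

(** At a zero x of f, the logarithmic derivative of f - i g is
    (f' - i g') / (- i g), whose imaginary part is f' / g. *)
Lemma hermite_biehler_sign f g x : no_root_above 0 (f - 'i%C *: g) ->
    f \is a polyOver Num.real -> g \is a polyOver Num.real ->
    x \is Num.real -> f.[x] = 0 ->
  f^`().[x] * g.[x] <= 0.
Proof.
move=> fg_up fR gR xR fx.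
have f'R : f^`().[x] \is Num.real by rewrite rpred_horner // polyOver_deriv.
have g'R : g^`().[x] \is Num.real by rewrite rpred_horner // polyOver_deriv.
have gxR : g.[x] \is Num.real by rewrite rpred_horner.
have [gx0|gx0] := eqVneq g.[x] 0; first by rewrite gx0 mulr0.
have := Im_dlog_le0 fg_up (Im_real xR).
rewrite derivB derivZ !hornerE /= fx sub0r oppr_eq0.
have /complex_realP[a ->] := f'R; have /complex_realP[b ->] := g'R.
have /complex_realP[c cE] := gxR; rewrite {}cE in gx0 *.
have {gx0} c0 : c != 0 by apply: contraNneq gx0 => ->.
move=> /(_ _)/wrap[].
  by rewrite mulf_neq0 // eq_complex /= ?oner_eq0 ?andbF // eqxx andbT.
have -> : (a%:C - 'i%C * b%:C) / - ('i%C * c%:C) = (b / c) +i* (a / c).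
  apply/eqP; rewrite eq_complex /=; apply/andP; split; apply/eqP; field; rewrite ?c0 //.
move=> /= ac; rewrite -rmorphM /= -(rmorph0 (real_complex R)) lecR.
have -> : a * c = a / c * c ^+ 2 by field.
by rewrite mulr_le0_ge0 // sqr_ge0.
Qed.

(** The difference of the two sides is f(x)^2 times the sum of the
    1 / (x - w)^2. *)
Lemma newton_strict f s x : f = \prod_(w <- s) ('X - w%:P) -> x \is Num.real ->
    all (fun w => (x != w) && (w \is Num.real)) s -> s != [::] ->
  f^`()^`().[x] * f.[x] < f^`().[x] ^+ 2.
Proof.
move=> fP xR /allP sP s0.
have fE : f^`().[x] ^+ 2 - f^`()^`().[x] * f.[x] =
    f.[x] ^+ 2 * \sum_(w <- s) (x - w)^-1 ^+ 2.
  rewrite {}fP {s0}; elim: s sP => [|w s IH] sP.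
    by rewrite !big_nil !derivC !hornerE; ring.
  rewrite !big_cons !derivM derivXsubC mul1r !derivD derivM derivXsubC mul1r.
  have /andP[xw _] := sP w (mem_head _ _); rewrite -subr_eq0 in xw.
  have {}IH := IH (fun v vs => sP v (mem_behead (vs : v \in behead (w :: s)))).
  rewrite !hornerE /=; set S := \sum_(_ <- _) _ in IH *.
  set P := \prod_(_ <- _) _ in IH *.
  transitivity ((x - w) ^+ 2 * (P^`().[x] ^+ 2 - P^`()^`().[x] * P.[x]) +
                P.[x] ^+ 2); first by ring.
  by rewrite IH; field.
rewrite -subr_gt0 fE mulr_gt0 //.
  rewrite real_exprn_even_gt0 //=.
    rewrite -[_ == 0]/(root f x) fP root_prod_XsubC.
    by apply/negP => /sP; rewrite eqxx.
  rewrite rpred_horner // fP big_seq rpred_prod // => w /sP/andP[_ wR].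
  by rewrite rpredB ?polyOverX ?polyOverC.
case: s s0 sP {fP fE} => // w s _ sP; rewrite big_cons ltr_wpDr //.
  rewrite big_seq; apply: sumr_ge0 => v vs.
  have /andP[_ vR] := sP v (mem_behead (vs : v \in behead (w :: s))).
  by rewrite real_exprn_even_ge0 // rpredV rpredB.
have /andP[xw wR] := sP w (mem_head _ _).
by rewrite real_exprn_even_gt0 ?rpredV ?rpredB // invr_eq0 subr_eq0.
Qed.

(** At a nonreal x all the terms of f'/f = sum_w 1 / (x - w) have nonzero
    imaginary parts of the same sign. *)
Lemma gauss_lucas_real f s x : f = \prod_(w <- s) ('X - w%:P) ->
    all (fun w => w \is Num.real) s -> s != [::] ->
  f.[x] != 0 -> f^`().[x] = 0 -> x \is Num.real.
Proof.
move=> fP /allP sP s0 fx f'x; case: x => a b in fx f'x *.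
set x := a +i* b in fx f'x *.
have xs w : w \in s -> x != w.
  move=> ws; apply: contraNneq fx => ->.
  by rewrite fP -[_ == 0]/(root _ w) root_prod_XsubC.
have {}xs : all (fun w => x != w) s by apply/allP.
have /eqP : f.[x] * \sum_(w <- s) (x - w)^-1 = 0.
  by rewrite -[RHS]f'x fP dlog_prod_seq.
rewrite mulf_eq0 (negPf fx) /= => /eqP/(congr1 Im) /=.
rewrite (big_morph _ ImD (erefl : Im 0 = 0)).
have -> : \sum_(w <- s) Im (x - w)^-1 =
    - b * \sum_(w <- s) (Re (x - w) ^+ 2 + Im (x - w) ^+ 2)^-1.
  rewrite mulr_sumr big_seq [RHS]big_seq; apply: eq_bigr => w /sP wR.
  by rewrite ImV; congr (_ / _); rewrite ImD ImN (Im_real wR) subr0.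
move/eqP; rewrite mulf_eq0 oppr_eq0 complex_real => /predU1P[-> //|].
suff P w : w \in s -> 0 < (Re (x - w) ^+ 2 + Im (x - w) ^+ 2)^-1.
  case: s s0 P {fP sP xs} => // w s _ P.
  rewrite big_cons paddr_eq0 ?(ltW (P _ (mem_head _ _))) //.
    by rewrite gt_eqF ?P ?mem_head.
  rewrite big_seq; apply: sumr_ge0 => v vs; apply/ltW/P.
  by rewrite inE vs orbT.
move=> /(allP xs) xw; rewrite invr_gt0 lt_def addr_ge0 ?sqr_ge0 // andbT.
rewrite paddr_eq0 ?sqr_ge0 // !sqrf_eq0; move: xw; rewrite -subr_eq0.
by case: (x - w) => u v; rewrite eq_complex.
Qed.

End UpperHalfPlane.

(** * The convolution as a polynomial family in the dilation parameter *)

Lemma monic_avg (A : comNzRingType) (I : finType) N (c : A) (f : I -> {poly A}) :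
    (forall i, f i \is monic) -> (forall i, size (f i) = N.+1) ->
    c * #|I|%:R = 1 ->
  c *: (\sum_i f i) \is monic /\ size (c *: (\sum_i f i)) = N.+1.
Proof.
move=> fm sf cI; set g := c *: _.
have gN : g`_N = 1.
  rewrite coefZ coef_sum (eq_bigr (fun=> 1)) => [|i _].
    by rewrite sumr_const.
  by have := fm i; rewrite monicE lead_coefE sf => /eqP.
have sg : size g = N.+1.
  apply/eqP; rewrite eqn_leq; apply/andP; split; last first.
    by rewrite ltnNge; apply/negP => /(nth_default 0)/eqP; rewrite gN oner_eq0.
  apply: leq_trans (size_scale_leq _ _) _; apply: leq_trans (size_sum _ _ _) _.
  by apply/bigmax_leqP => i _; rewrite sf.
by split=> //; rewrite monicE lead_coefE sg gN.
Qed.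

Section Family.
Variables (R : rcfType) (n : nat) (m l : 'I_n.+1 -> R).
Local Notation C := R[i].
Implicit Types (t x : C) (w : 'I_n.+1 -> C).

(** The convolution of the polynomials with roots t m_i and l_i, with t the
    variable of the coefficient ring. *)
Definition conv : {poly {poly C}} :=
  ((n.+1`!%:R : C)^-1)%:P *: \sum_(s : 'S_n.+1)
     \prod_i ('X - ((m i)%:C *: 'X + ((l (s i))%:C)%:P)%:P).

Definition conv_at t : {poly C} :=
  (n.+1`!%:R)^-1 *: \sum_(s : 'S_n.+1)
     \prod_i ('X - (t * (m i)%:C + (l (s i))%:C)%:P).

(** Deleting the i-th factor, with weight w_i.  The derivatives of the convolution
    in x and in t both have this form, with weights 1 and - m_i. *)
Definition conv_diff w t : {poly C} :=
  (n.+1`!%:R)^-1 *: \sum_i w i *: \sum_(s : 'S_n.+1)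
     \prod_(j | j != i) ('X - (t * (m j)%:C + (l (s j))%:C)%:P).

Lemma fact_neq0 k : (k`!%:R : C) != 0.
Proof. by rewrite pnatr_eq0 -lt0n fact_gt0. Qed.

Lemma eval_coef_conv t : eval_coef t conv = conv_at t.
Proof.
rewrite /eval_coef /conv map_polyZ /= horner_evalE hornerC rmorph_sum /=.
congr (_ *: _); apply: eq_bigr => s _; rewrite rmorph_prod /=.
apply: eq_bigr => i _; rewrite rmorphB /= map_polyX map_polyC /=.
by rewrite horner_evalE hornerD hornerZ hornerX hornerC mulrC.
Qed.

Lemma conv_monic : conv \is monic /\ size conv = n.+2.
Proof.
apply: monic_avg => [s|s|]; first exact: monic_prod_XsubC.
  exact: size_prod_ord_XsubC.
by rewrite card_Sn -(rmorph_nat (@polyC C)) -rmorphM mulVf ?fact_neq0.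
Qed.

Lemma conv_at_monic t : conv_at t \is monic /\ size (conv_at t) = n.+2.
Proof.
apply: monic_avg => [s|s|]; first exact: monic_prod_XsubC.
  exact: size_prod_ord_XsubC.
by rewrite card_Sn mulVf ?fact_neq0.
Qed.

Lemma conv_at_real (t : R) : conv_at t%:C \is a polyOver Num.real.
Proof.
rewrite polyOverZ ?rpredV ?realn // rpred_sum // => s _.
rewrite rpred_prod // => i _; rewrite rpredB ?polyOverX ?polyOverC //.
by rewrite -rmorphM -rmorphD complex_real.
Qed.

Lemma conv_diff_real w (t : R) : (forall i, w i \is Num.real) ->
  conv_diff w t%:C \is a polyOver Num.real.
Proof.
move=> wR; rewrite polyOverZ ?rpredV ?realn // rpred_sum // => i _.
rewrite polyOverZ // rpred_sum // => s _.
rewrite rpred_prod // => j _; rewrite rpredB ?polyOverX ?polyOverC //.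
by rewrite -rmorphM -rmorphD complex_real.
Qed.

Lemma deriv_conv_at t : (conv_at t)^`() = conv_diff (fun=> 1) t.
Proof.
rewrite /conv_at derivZ deriv_sum; congr (_ *: _).
under eq_bigr do rewrite deriv_prodXsubC.
by rewrite exchange_big /=; apply: eq_bigr => i _; rewrite scale1r.
Qed.

Lemma horner_conv_diff_sum w t x : (conv_diff w t).[x] =
  (n.+1`!%:R)^-1 * \sum_i w i * \sum_(s : 'S_n.+1)
     \prod_(j | j != i) (x - (t * (m j)%:C + (l (s j))%:C)).
Proof.
rewrite /conv_diff hornerZ horner_sum; congr (_ * _).
apply: eq_bigr => i _; rewrite hornerZ horner_sum; congr (_ * _).
apply: eq_bigr => s _; rewrite (@horner_prod C).
by apply: eq_bigr => j _; rewrite hornerXsubC.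
Qed.

Lemma deriv_coef_conv t : deriv_coef t conv = conv_diff (fun i => - (m i)%:C) t.
Proof.
apply: poly_fun_inj => x; rewrite horner_deriv_coef /conv hornerZ horner_sum.
rewrite derivM derivC mul0r add0r hornerM hornerC.
rewrite [RHS]horner_conv_diff_sum; congr (_ * _).
rewrite deriv_sum horner_sum.
transitivity (\sum_i \sum_(s : 'S_n.+1)
    - (m i)%:C * \prod_(j | j != i) (x - (t * (m j)%:C + (l (s j))%:C))).
  rewrite exchange_big /=; apply: eq_bigr => s _.
  rewrite (@horner_prod {poly C}) deriv_prod_ord (@horner_sum C).
  apply: eq_bigr => i _; rewrite hornerM (@horner_prod C); congr (_ * _).
    rewrite hornerXsubC derivB derivD derivZ derivX !derivC.
    by rewrite addr0 sub0r alg_polyC hornerN hornerC.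
  by apply: eq_bigr => j _; rewrite !hornerE mulrC.
by apply: eq_bigr => i _; rewrite mulr_sumr.
Qed.

Lemma conv_diffD w w' t :
  conv_diff (fun i => w i + w' i) t = conv_diff w t + conv_diff w' t.
Proof.
rewrite /conv_diff -scalerDr -big_split /=; congr (_ *: _).
by apply: eq_bigr => i _; rewrite scalerDl.
Qed.

Lemma conv_diffZ w c t : conv_diff (fun i => c * w i) t = c *: conv_diff w t.
Proof.
rewrite /conv_diff scalerA mulrC -scalerA scaler_sumr; congr (_ *: _).
by apply: eq_bigr => i _; rewrite scalerA.
Qed.

Lemma conv_diff_coef w t : (size (conv_diff w t) <= n.+1)%N /\
  (conv_diff w t)`_n = \sum_i w i.
Proof.
have sP (s : 'S_n.+1) i :
    let f := \prod_(j | j != i) ('X - (t * (m j)%:C + (l (s j))%:C)%:P) in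
    size f = n.+1 /\ f \is monic.
  move=> f; rewrite /f prod_neq_lift; split; last exact: monic_prod_XsubC.
  exact: size_prod_ord_XsubC.
split.
  apply: leq_trans (size_scale_leq _ _) _; apply: leq_trans (size_sum _ _ _) _.
  apply/bigmax_leqP => i _; apply: leq_trans (size_scale_leq _ _) _.
  apply: leq_trans (size_sum _ _ _) _; apply/bigmax_leqP => s _.
  by case: (sP s i) => ->.
rewrite /conv_diff coefZ coef_sum mulr_sumr; apply: eq_bigr => i _.
rewrite coefZ coef_sum (eq_bigr (fun=> 1)) => [|s _].
  by rewrite sumr_const card_Sn mulrC mulfK ?fact_neq0.
by have [sf] := sP s i; rewrite monicE lead_coefE sf => /eqP.
Qed.

(** The poles at which [polarize] computes the value at 0 of the convolution with
    the polynomial of roots l_k; the value at x is obtained by translating the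
    other roots by - x, so that all poles stay real. *)
Definition opp_roots : seq C := [seq - (l k)%:C | k <- enum 'I_n.+1].

Lemma opp_roots_nth (k : 'I_n.+1) : opp_roots`_k = - (l k)%:C.
Proof. by rewrite (nth_map k) ?size_enum_ord // nth_ord_enum. Qed.

Lemma size_opp_roots : size opp_roots = n.+1.
Proof. by rewrite size_map size_enum_ord. Qed.

Lemma horner_conv_at t x : (conv_at t).[x] =
  (n.+1`!%:R)^-1 *
     polarize opp_roots (\prod_i ('X - (t * (m i)%:C - x)%:P)).
Proof.
rewrite /conv_at hornerZ horner_sum polarize_prod ?size_opp_roots //; congr (_ * _).
apply: eq_bigr => s _; rewrite (@horner_prod C); apply: eq_bigr => i _.
by rewrite opp_roots_nth !hornerE; ring.
Qed.

Lemma horner_conv_diff w t x : (conv_diff w t).[x] =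
  (n.+1`!%:R)^-1 * polarize opp_roots
     (\sum_i w i *: \prod_(j | j != i) ('X - (t * (m j)%:C - x)%:P)).
Proof.
rewrite horner_conv_diff_sum polarize_sum; congr (_ * _).
apply: eq_bigr => i _; rewrite polarizeZ; congr (_ * _).
rewrite polarize_prod_neq ?size_opp_roots //.
apply: eq_bigr => s _; apply: eq_bigr => j _.
by rewrite opp_roots_nth; ring.
Qed.

Lemma no_root_above_prod (t : R) x : no_root_above (- complex.Im x)
  (\prod_i ('X - (t%:C * (m i)%:C - x)%:P)).
Proof.
move=> z xz; rewrite horner_prod; apply/prodf_neq0 => i _.
rewrite hornerXsubC subr_eq0; apply: contraTneq xz => ->.
by rewrite -rmorphM ImD ImN add0r ltxx.
Qed.

Lemma opp_roots_above x : 0 < complex.Im x ->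
  all (fun z => - complex.Im x < complex.Im z) opp_roots.
Proof.
move=> x0; apply/allP => _ /mapP[k _ ->].
by rewrite ImN oppr0 oppr_lt0.
Qed.

Lemma conv_at_no_root (t : R) : no_root_above 0 (conv_at t%:C).
Proof.
move=> x x0; rewrite horner_conv_at mulf_neq0 ?invr_eq0 ?fact_neq0 //.
apply: polarize_neq0 (opp_roots_above x0); first exact: no_root_above_prod.
by rewrite size_prod_ord_XsubC size_opp_roots.
Qed.

(** For t > 0, r' - i dr/dt has no zero in the upper half plane: it is obtained
    from the polynomial of roots t m_i by a polar derivative with pole i t
    followed by the polarization at real points, and translating by - x puts all
    roots on the line Im = - Im x, strictly below all these poles. *)
Lemma conv_diff_no_root (t : R) : 0 < t ->
  no_root_above 0 (conv_diff (fun i => 1 + 'i%C * (m i)%:C) t%:C).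
Proof.
move=> t0 x x0; rewrite horner_conv_diff mulf_neq0 ?invr_eq0 ?fact_neq0 //.
have tC : t%:C != 0 by rewrite (inj_eq (@complexI R) t 0) gt_eqF.
set q := \prod_i ('X - (t%:C * (m i)%:C - x)%:P).
have -> : \sum_i (1 + 'i%C * (m i)%:C) *:
      \prod_(j | j != i) ('X - (t%:C * (m j)%:C - x)%:P) =
    (- ('i%C / t%:C)) *: polar n.+1 ('i%C * t%:C - x) q.
  rewrite polar_prod scaler_sumr; apply: eq_bigr => i _; rewrite scalerA.
  congr (_ *: _); have i2 : 'i%C ^+ 2 = -1 :> C := sqr_i _.
  transitivity (- ('i%C ^+ 2) + 'i%C * (m i)%:C); first by rewrite i2 opprK.
  by field.
rewrite polarizeZ mulf_neq0 //.
  by rewrite oppr_eq0 mulf_neq0 ?invr_eq0 // eq_complex /= oner_eq0 andbF.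
have sq : (size q <= n.+2)%N by rewrite size_prod_ord_XsubC.
apply: polarize_neq0 (opp_roots_above x0); last first.
  by rewrite size_opp_roots (leq_trans (size_polar _ sq)).
apply: laguerre => //; first exact: no_root_above_prod.
by rewrite ImD ImN ltrDr /= mul1r mul0r add0r.
Qed.

(** No root is above the real axis; the coefficients are real, so none is below
    either. *)
Lemma conv_at_roots_real (t : R) x : root (conv_at t%:C) x -> x \is Num.real.
Proof.
move=> rx; have rx' : root (conv_at t%:C) x^*%C.
  have -> : conv_at t%:C = map_poly conjc (conv_at t%:C).
    rewrite map_poly_id // => c /(allP (conv_at_real t)).
    by move=> /complex_realP[k ->]; exact: conjc_real.
  by rewrite complex_root_conj conjcK.
have Ile0 y : root (conv_at t%:C) y -> complex.Im y <= 0.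
  move=> ry; rewrite leNgt; apply: contraL ry => /conv_at_no_root; exact.
have := Ile0 _ rx'; have := Ile0 _ rx; case: (x) => a b /= b0.
by rewrite oppr_le0 complex_real eq_le b0 => ->.
Qed.

End Family.

(** * Logarithmic derivative of the discriminant of the family *)

Lemma monic_real_split (R : rcfType) n (p : {poly R[i]}) :
    p \is monic -> size p = n.+1 -> (forall z, root p z -> z \is Num.real) ->
  exists l : 'I_n -> R, p = \prod_i ('X - ((l i)%:C)%:P).
Proof.
move=> mp sp pR; have [s sE] := closed_field_poly_normal p.
move: mp (sE); rewrite monicE => /eqP ->; rewrite scale1r => {}sE.
have ss : size s = n by apply/eqP; rewrite -eqSS -sp sE size_prod_XsubC.
exists (fun i => complex.Re s`_i); rewrite sE (big_nth 0) ss big_mkord.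
apply: eq_bigr => i _; rewrite RRe_real // pR // sE root_prod_XsubC.
by rewrite mem_nth ?ss.
Qed.

Lemma inj_of_deriv_neq0 (K : fieldType) k (g : 'I_k -> K) :
  (forall i, (\prod_j ('X - (g j)%:P))^`().[g i] != 0) -> injective g.
Proof.
move=> g0 i j gij; apply/eqP; have := g0 i; rewrite deriv_at_root.
by apply: contraR => ij; rewrite (bigD1 j) 1?eq_sym //= gij subrr mul0r.
Qed.

Section Discriminant.
Variables (R : rcfType) (n : nat) (m l : 'I_n.+1 -> R).
Local Notation C := R[i].
Local Notation conv := (conv m l).
Local Notation conv_at := (conv_at m l).
Local Notation conv_diff := (conv_diff m l).

(** The discriminant of the convolution up to sign, as a polynomial in t. *)
Definition conv_disc : {poly C} := resm n conv conv^`().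

Lemma horner_conv_disc t : conv_disc.[t] = resm n (conv_at t) (conv_at t)^`().
Proof.
by rewrite -horner_evalE resm_map -!/(eval_coef t _) -deriv_eval_coef eval_coef_conv.
Qed.

Lemma conv_at_split (t : R) :
  exists g : 'I_n.+1 -> R, conv_at t%:C = \prod_i ('X - ((g i)%:C)%:P).
Proof.
have [mr sr] := conv_at_monic m l t%:C.
exact: monic_real_split mr sr (@conv_at_roots_real _ _ m l t).
Qed.

(** L is the sum of h(nu) / r(nu) over the critical points nu of r, where h is the
    derivative in t.  If it vanishes then so does h at every nu; the nu are
    distinct, and the combination of h and r' with vanishing coefficient of
    degree n then has too many zeros. *)
Lemma conv_disc_dlog (t : R) : 0 < t -> conv_disc.[t%:C] != 0 ->
  exists L : C, [/\ 0 <= L, conv_disc^`().[t%:C] = conv_disc.[t%:C] * L &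
    L = 0 -> conv_diff (fun i => (m i)%:C - (\sum_j (m j)%:C) / n.+1%:R) t%:C = 0].
Proof.
move=> t0 D0; have [g gE] := conv_at_split t.
have [mr sr] := conv_at_monic m l t%:C.
have [mF sF] := conv_monic m l.
set r := conv_at t%:C in gE mr sr.
have convE0 : eval_coef t%:C conv = r by rewrite eval_coef_conv.
pose gc i := (g i)%:C.
have r'g0 i : r^`().[gc i] != 0.
  move: D0; rewrite horner_conv_disc -/r {1}gE resm_roots => /prodf_neq0.
  exact.
have g_inj : injective gc by apply: inj_of_deriv_neq0; rewrite -gE.
have [s sE] := closed_field_poly_normal r^`().
have r'n : (r^`())`_n = n.+1%:R.
  by move: mr; rewrite monicE lead_coefE sr coef_deriv => /eqP ->.
have sr' : size r^`() = n.+1.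
  apply/eqP; rewrite eqn_leq; apply/andP; split.
    by rewrite (leq_trans (size_poly _ _)) // sr.
  rewrite ltnNge; apply/negP => /(nth_default 0)/eqP.
  by rewrite r'n pnatr_eq0.
have lr' : lead_coef r^`() = n.+1%:R by rewrite lead_coefE sr' r'n.
rewrite lr' in sE.
have ss : size s = n.
  apply/eqP; rewrite -eqSS -sr' sE size_scale ?pnatr_eq0 //.
  by rewrite size_prod_XsubC.
pose nu (k : 'I_n) := s`_k.
have nuE : r^`() = n.+1%:R *: \prod_k ('X - (nu k)%:P).
  by rewrite sE (big_nth 0) ss big_mkord.
have r'nu k : r^`().[nu k] = 0.
  by rewrite nuE hornerZ horner_prod (bigD1 k) //= hornerXsubC subrr mul0r mulr0.
have rnu k : r.[nu k] != 0.
  apply/negP; rewrite {1}gE horner_prod => /eqP/eqP/prodf_eq0[i _].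
  rewrite hornerXsubC subr_eq0 => /eqP e.
  by have := r'g0 i; rewrite -[gc i]e r'nu eqxx.
pose gs := [seq gc i | i <- enum 'I_n.+1].
have gsE : r = \prod_(w <- gs) ('X - w%:P) by rewrite gE big_map big_enum.
have gsR : all (fun w => w \is Num.real) gs.
  by apply/allP => _ /mapP[i _ ->]; rewrite complex_real.
have gs0 : gs != [::] by rewrite -size_eq0 size_map size_enum_ord.
have nuR k : nu k \is Num.real := gauss_lucas_real gsE gsR gs0 (rnu k) (r'nu k).
have r'' k : r^`()^`().[nu k] * r.[nu k] < 0.
  rewrite -[X in _ < X](expr0n C 2) -(r'nu k).
  apply: (newton_strict gsE) => //; apply/allP => w wgs.
  rewrite (allP gsR) // andbT; apply: contraNneq (rnu k) => ->.
  by rewrite gsE -[_ == 0]/(root _ w) root_prod_XsubC.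
pose h := deriv_coef t%:C conv; have hE := deriv_coef_conv m l t%:C; rewrite -/h in hE.
have hR : h \is a polyOver Num.real.
  by rewrite hE conv_diff_real // => i; rewrite rpredN complex_real.
have rR : r \is a polyOver Num.real by exact: conv_at_real.
have r'R : r^`() \is a polyOver Num.real by rewrite polyOver_deriv.
have hb k : r^`()^`().[nu k] * h.[nu k] <= 0.
  apply: hermite_biehler_sign => //.
  have -> : r^`() - 'i%C *: h = conv_diff (fun i => 1 + 'i%C * (m i)%:C) t%:C.
    rewrite conv_diffD -deriv_conv_at conv_diffZ hE -scalerN; congr (_ + _ *: _).
    rewrite -scaleN1r -conv_diffZ; congr (conv_diff _ _).
    by apply/funext => i; rewrite mulN1r opprK.
  exact: conv_diff_no_root.
(* Where h does not vanish, h and r both have the sign opposite to r''. *)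
have terms k : 0 <= h.[nu k] / r.[nu k].
  have := r'' k; set a := _^`().[_]; set b := h.[_]; set c := r.[_] => ac.
  have -> : b / c = (a * b) * (a * c) / (a * c * (a * c)).
    have := ltr0_neq0 ac; rewrite mulf_eq0 negb_or => /andP[a0 c0].
    by field; rewrite a0 c0.
  by rewrite divr_ge0 ?mulr_le0 ?hb // ltW.
exists (\sum_k h.[nu k] / r.[nu k]); split; first exact: sumr_ge0.
  rewrite /conv_disc (resm_deriv_dlog (nu := nu) mF sF g_inj) ?convE0 //; exact: gE.
move=> L0.
have hnu k : h.[nu k] = 0.
  have /eqP : h.[nu k] / r.[nu k] = 0.
    by rewrite (psumr_eq0P (fun i _ => terms i) L0).
  by rewrite mulf_eq0 invr_eq0 (negPf (rnu k)) orbF => /eqP.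
have nu_inj : injective nu.
  apply: inj_of_deriv_neq0 => k; apply: contraTneq (r'' k) => e.
  by rewrite nuE derivZ hornerZ e mulr0 mul0r ltxx.
set w := fun i => _; apply: (@roots_geq_poly_eq0 _ _ (codom nu)).
- apply/allP => _ /codomP[k ->]; rewrite /root.
  have -> : conv_diff w t%:C = - h - ((\sum_j (m j)%:C) / n.+1%:R) *: r^`().
    rewrite hE /r deriv_conv_at -scaleN1r -scaleNr -!conv_diffZ -conv_diffD.
    by congr (conv_diff _ _); apply/funext => i; rewrite /w; ring.
  by rewrite hornerD !hornerN hornerZ hnu r'nu mulr0 oppr0 addr0.
- by rewrite map_inj_uniq ?enum_uniq.
rewrite size_codom card_ord.
have [sw cw] := conv_diff_coef m l w t%:C.
apply/leq_sizeP => j; rewrite leq_eqVlt => /predU1P[<-|nj].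
  by rewrite cw /w sumrB sumr_const card_ord -[X in _ - X]mulr_natr divfK ?subrr.
by rewrite nth_default // (leq_trans sw).
Qed.

End Discriminant.

(** * Discriminants, and monotonicity of real polynomials *)

Lemma prod_offdiag (A : comNzRingType) k (a : 'I_k -> 'I_k -> A) :
  \prod_i \prod_(j | j != i) a i j =
  \prod_(j < k) \prod_(i < k | (i < j)%N) (a i j * a j i).
Proof.
under [RHS]eq_bigr do rewrite big_split.
rewrite [RHS]big_split /= [X in _ = X * _](exchange_big_dep xpredT) //=.
rewrite -[RHS]big_split /=.
apply: eq_bigr => i _; rewrite (bigID (fun j : 'I_k => (i < j)%N)) /=.
congr (_ * _); apply: eq_bigl => j; last by rewrite -leqNgt ltn_neqAle.
by rewrite andb_idl // => /gtn_eqF/negbT.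
Qed.

Section Dis.
Variable R : realType.
Local Notation C := R[i].
Local Notation roots := (@Defs.roots R).
Implicit Types p : {poly C}.

Lemma monic_rootsE p : p \is monic -> p = \prod_(z <- roots p) ('X - z%:P).
Proof.
move=> /monicP mp; have := svalP (closed_field_poly_normal p).
by rewrite -/(roots p) mp scale1r.
Qed.

Lemma mem_roots p z : p \is monic -> (z \in roots p) = root p z.
Proof. by move=> mp; rewrite {2}(monic_rootsE mp) root_prod_XsubC. Qed.

Lemma size_roots p k : p \is monic -> size p = k.+1 -> size (roots p) = k.
Proof.
by move=> /monic_rootsE pE /eqP; rewrite {1}pE size_prod_XsubC eqSS => /eqP.
Qed.

Lemma monic_rootsE_ord p k : p \is monic -> size p = k.+1 ->
  p = \prod_(i < k) ('X - ((roots p)`_i)%:P).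
Proof.
move=> mp sp; rewrite {1}(monic_rootsE mp) (big_nth 0) (size_roots mp sp).
by rewrite big_mkord.
Qed.

(** (-1)^('C(k, 2)), in the shape in which it is factored out of the double
    product of [Dis]. *)
Definition disc_sign k : C := \prod_(j < k) \prod_(i < j) -1.

Lemma Dis_ord p k : p \is monic -> size p = k.+1 ->
  Dis p = \prod_(j < k) \prod_(i < k | (i < j)%N)
            ((roots p)`_i - (roots p)`_j) ^+ 2.
Proof.
move=> mp sp; rewrite /Dis (size_roots mp sp); apply: eq_bigr => j _.
by rewrite (big_ord_widen k (fun i => ((roots p)`_i - (roots p)`_j) ^+ 2)) // ltnW.
Qed.

(** r'(z_i) is the product of the z_i - z_j over j != i; pairing (i, j) with (j, i)
    gives minus a square for each unordered pair. *)
Lemma Dis_resm p n : p \is monic -> size p = n.+2 ->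
  Dis p = disc_sign n.+1 * resm n p p^`().
Proof.
move=> mp sp; rewrite (Dis_ord mp sp); pose z (i : 'I_n.+1) := (roots p)`_i.
have -> : resm n p p^`() = \prod_i \prod_(j | j != i) (z i - z j).
  rewrite [X in resm _ X _](monic_rootsE_ord mp sp) resm_roots.
  apply: eq_bigr => i _; rewrite [X in X^`()](monic_rootsE_ord mp sp).
  exact: (deriv_at_root z i).
rewrite prod_offdiag /disc_sign -big_split /=; apply: eq_bigr => j _.
rewrite (big_ord_widen n.+1 (fun=> -1 : C)) 1?ltnW // -big_split /=.
by apply: eq_bigr => i _; rewrite /z; ring.
Qed.

Lemma Dis_ge0 p : p \is monic -> real_rooted p -> 0 <= Dis p.
Proof.
move=> mp pR; apply: prodr_ge0 => j _; apply: prodr_ge0 => i _.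
have rR z : z \in roots p -> z \is Num.real.
  by rewrite mem_roots // => /pR.
by rewrite real_exprn_even_ge0 // rpredB ?rR ?mem_nth // (ltn_trans _ (ltn_ord j)).
Qed.

Lemma Dis_neq0 p : (Dis p != 0) = uniq (roots p).
Proof.
apply/idP/idP => [/prodf_neq0 P|u].
  apply/(uniqP 0) => i j; rewrite !inE => si sj; apply: contra_eq => ij.
  wlog lij : i j si sj ij / (i < j)%N.
    move=> W; have := ij; rewrite neq_ltn => /orP[|ji]; first exact: W.
    by rewrite eq_sym; apply: W ji; rewrite // eq_sym.
  have /prodf_neq0 /(_ (Ordinal lij) isT) := P (Ordinal sj) isT.
  by rewrite expf_eq0 /= subr_eq0.
apply/prodf_neq0 => j _; apply/prodf_neq0 => i _.
rewrite expf_eq0 /= subr_eq0 nth_uniq ?ltn_eqF //.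
exact: ltn_trans (ltn_ord i) (ltn_ord j).
Qed.

End Dis.

Section RealPoly.
Variable R : rcfType.
Implicit Types P : {poly R}.

(** A negative derivative at a zero would make P negative just to the right. *)
Lemma deriv_ge0_at_zero P t : (forall x, 0 <= P.[x]) -> P.[t] = 0 -> 0 <= P^`().[t].
Proof.
move=> P0 Pt; rewrite leNgt; apply/negP => P't.
have [e e0 He] := polyrcf.poly_cont t P^`() (eqbRL (oppr_gt0 _) P't).
have : (- P).[t] < (- P).[t + e / 2].
  apply: (@polyrcf.derpr _ _ t (t + e / 2)); last first.
    by rewrite in_itv /= lexx ltrDl divr_gt0.
  move=> x; rewrite in_itv /= => /andP[tx xe].
  rewrite derivN hornerN oppr_gt0.
  have /He : `|x - t| < e.
    rewrite gtr0_norm ?subr_gt0 // ltrBlDl (lt_trans xe) // ltrD2l.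
    by rewrite ltr_pdivrMr // ltr_pMr // ltr1n.
  by rewrite ltr_norml => /andP[_]; rewrite ltrBlDr addNr.
by rewrite !hornerN Pt oppr0 oppr_gt0 ltNge P0.
Qed.

Lemma poly_mono P : (forall x, 0 <= P.[x]) ->
    (forall t, 0 < t -> P.[t] != 0 -> 0 <= P^`().[t]) ->
  forall s t, 0 <= s -> s <= t -> P.[s] <= P.[t].
Proof.
move=> P0 P' s t s0 st.
apply: (@polyrcf.ler_hornerW _ s t P); rewrite ?in_itv /= ?lexx ?st //.
move=> x; rewrite in_itv /= => /andP[sx _].
have [/(deriv_ge0_at_zero P0)//|] := eqVneq P.[x] 0.
by apply: P'; exact: le_lt_trans sx.
Qed.

(** A monotone polynomial with equal values at s < t is constant between them,
    hence constant. *)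
Lemma poly_smono P : (forall s t, 0 <= s -> s <= t -> P.[s] <= P.[t]) ->
  P^`() != 0 -> forall s t, 0 <= s -> s < t -> P.[s] < P.[t].
Proof.
move=> Pm P' s t s0 st; rewrite lt_neqAle Pm ?(ltW st) // andbT.
apply: contra_neq P' => e.
pose u k := s + (t - s) / k.+1%:R.
have ts : t - s != 0 by rewrite subr_eq0 gt_eqF.
suff E : P - P.[s]%:P = 0.
  by rewrite -[P](subrK P.[s]%:P) E add0r derivC.
apply: (poly_eq0_seq (u := u)) => [i j /addrI/(mulfI ts)/invr_inj/eqP|k].
  by rewrite eqr_nat => /eqP[].
rewrite hornerD hornerN hornerC; apply/eqP; rewrite subr_eq0 eq_le.
have s_u : s <= u k by rewrite lerDl divr_ge0 ?subr_ge0 ?(ltW st).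
have u_t : u k <= t.
  rewrite /u -lerBrDl ler_pdivrMr ?ltr0n // ler_peMr ?subr_ge0 ?(ltW st) //.
  by rewrite ler1n.
by rewrite {1}e !Pm // (le_trans s0).
Qed.

End RealPoly.

(** * Monotonicity of the discriminant for positive dilations *)

Section RePoly.
Variable R : rcfType.
Local Notation C := R[i].
Local Notation Re := (@complex.Re R).

(** The real parts of the coefficients.  On the real line this is the real part of
    P; it brings discriminants, which are defined as complex numbers, back to real
    polynomials. *)
Definition re_poly (P : {poly C}) : {poly R} := \poly_(i < size P) Re P`_i.

Lemma coef_re_poly P i : (re_poly P)`_i = Re P`_i.
Proof. by rewrite coef_poly; case: ltnP => // /(nth_default 0) ->. Qed.

Lemma ReD (x y : C) : Re (x + y) = Re x + Re y.
Proof. by case: x y => [? ?] []. Qed.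

Lemma horner_re_poly P x : (re_poly P).[x] = Re P.[x%:C].
Proof.
rewrite horner_poly horner_coef (big_morph _ ReD (erefl : Re 0 = 0)).
apply: eq_bigr => i _; rewrite -rmorphXn /=; case: (P`_i) => a b /=.
by rewrite mulr0 subr0.
Qed.

Lemma deriv_re_poly P : (re_poly P)^`() = re_poly P^`().
Proof.
apply/polyP => i; rewrite coef_deriv !coef_re_poly coef_deriv.
by elim: {2 4}i.+1 => [|k IH]; rewrite ?mulr0n // !mulrS ReD IH.
Qed.

End RePoly.

Section Monotone.
Variables (R : realType) (n : nat) (m l : 'I_n.+1 -> R).
Local Notation C := R[i].
Local Notation conv_at := (conv_at m l).
Local Notation conv_diff := (conv_diff m l).

Definition dis_poly : {poly R} := re_poly (disc_sign R n.+1 *: conv_disc m l).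

Lemma Dis_conv_at_ge0 (t : R) : 0 <= Dis (conv_at t%:C).
Proof.
apply: Dis_ge0; first by case: (conv_at_monic m l t%:C).
exact: conv_at_roots_real.
Qed.

Lemma Dis_conv_disc t : Dis (conv_at t) = disc_sign R n.+1 * (conv_disc m l).[t].
Proof.
by have [? ?] := conv_at_monic m l t; rewrite (Dis_resm (n := n)) // horner_conv_disc.
Qed.

Lemma Dis_conv_at (t : R) : Dis (conv_at t%:C) = (dis_poly.[t])%:C.
Proof.
rewrite horner_re_poly hornerZ -Dis_conv_disc RRe_real //.
exact: ger0_real (Dis_conv_at_ge0 t).
Qed.

Lemma dis_poly_ge0 t : 0 <= dis_poly.[t].
Proof. by rewrite -ler0c -Dis_conv_at Dis_conv_at_ge0. Qed.

Lemma dis_poly_dlog t : 0 < t -> dis_poly.[t] != 0 ->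
  exists L : R, [/\ 0 <= L, dis_poly^`().[t] = dis_poly.[t] * L &
    L = 0 -> conv_diff (fun i => (m i - (\sum_j m j) / n.+1%:R)%:C) t%:C = 0].
Proof.
move=> t0 Dt.
have Dt' : (conv_disc m l).[t%:C] != 0.
  apply: contraNneq Dt => e; rewrite -(inj_eq (@complexI R)) -Dis_conv_at.
  by rewrite Dis_conv_disc e mulr0.
have [L [L0 LE Lz]] := conv_disc_dlog t0 Dt'.
have LR : L = (complex.Re L)%:C by rewrite RRe_real // ger0_real.
exists (complex.Re L); split.
- by rewrite -ler0c -LR.
- rewrite deriv_re_poly horner_re_poly derivZ hornerZ LE mulrA -Dis_conv_disc.
  by rewrite Dis_conv_at LR -rmorphM.
move=> rL; rewrite -{}Lz; last by rewrite LR rL.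
congr (conv_diff _ _); apply/funext => i.
by rewrite rmorphB fmorph_div /= rmorph_sum rmorph_nat.
Qed.

Lemma dis_poly_mono s t : 0 <= s -> s <= t -> dis_poly.[s] <= dis_poly.[t].
Proof.
apply: poly_mono dis_poly_ge0 _ _ _ => {s} {}t t0 Dt.
have [L [L0 -> _]] := dis_poly_dlog t0 Dt.
by rewrite mulr_ge0 ?dis_poly_ge0.
Qed.

(** Put x = t y and divide by t^n: the equation becomes polynomial in 1 / t and
    holds for infinitely many values, hence also at 1 / t = 0, where the l_k
    disappear.  For y to the right of all m_i, dividing by prod_j (y - m_j) and
    using that m_i - w_i does not depend on i and that the w_i sum to 0 gives
    sum_i w_i^2 / (y - m_i) = 0, a sum of nonnegative terms. *)
Lemma conv_diff_eq0 (w : 'I_n.+1 -> R) : \sum_i w i = 0 ->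
    (forall i j, m i - m j = w i - w j) ->
    (forall t : R, 0 < t -> conv_diff (fun i => (w i)%:C) t%:C = 0) ->
  forall i, w i = 0.
Proof.
move=> w0 mw W0.
have prod0 (y : R) : \sum_i w i * \prod_(j | j != i) (y - m j) = 0.
  (* The variable of P stands for 1 / t. *)
  pose P : {poly C} := \sum_i ((w i)%:C) *: \sum_(s : 'S_n.+1)
    \prod_(j | j != i) (((y - m j)%:C)%:P - (l (s j))%:C *: 'X).
  have Ph (x : C) : P.[x] = \sum_i (w i)%:C * \sum_(s : 'S_n.+1)
      \prod_(j | j != i) ((y - m j)%:C - (l (s j))%:C * x).
    rewrite horner_sum; apply: eq_bigr => i _; rewrite hornerZ horner_sum.
    congr (_ * _); apply: eq_bigr => s _; rewrite (@horner_prod C).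
    by apply: eq_bigr => j _; rewrite !hornerE.
  have P0 : P = 0.
    apply: (poly_eq0_seq (u := fun k => k.+1%:R)) => [i j /eqP|k].
      by rewrite eqr_nat => /eqP[].
    pose t : R := k.+1%:R^-1; have t0 : 0 < t by rewrite invr_gt0 ltr0n.
    have tk : t%:C * k.+1%:R = 1.
      by rewrite -(rmorph_nat (real_complex R)) -rmorphM mulVf ?pnatr_eq0.
    have /(congr1 (fun q : {poly C} => q.[(t * y)%:C])) := W0 _ t0.
    rewrite horner0 horner_conv_diff_sum => /eqP.
    rewrite mulf_eq0 invr_eq0 (negPf (fact_neq0 _ _)) /= => /eqP W.
    rewrite Ph -[RHS](mulr0 (k.+1%:R ^+ n)) -[in RHS]W mulr_sumr.
    apply: eq_bigr => i _; rewrite [RHS]mulrCA; congr (_ * _).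
    rewrite mulr_sumr; apply: eq_bigr => s _.
    have -> : (k.+1%:R ^+ n : C) = \prod_(j | j != i) (k.+1%:R).
      rewrite prodr_const (cardC1 i) card_ord //.
    rewrite -big_split /=; apply: eq_bigr => j _.
    move: tk; set K := k.+1%:R => tk.
    rewrite rmorphB rmorphM /=.
    transitivity ((t%:C * K) * (y%:C - (m j)%:C) - K * (l (s j))%:C).
      by rewrite tk; ring.
    by ring.
  have := Ph 0; rewrite P0 horner0 => /esym/eqP.
  rewrite (eq_bigr (fun i => n.+1`!%:R *
      (w i * \prod_(j | j != i) (y - m j))%:C)) => [|i _]; last first.
    rewrite (eq_bigr (fun=> (\prod_(j | j != i) (y - m j))%:C)) => [|s _].
      by rewrite sumr_const card_Sn rmorphM -[X in _ * X = _]mulr_natl mulrCA.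
    rewrite rmorph_prod; apply: eq_bigr => j _.
    by rewrite mulr0 subr0.
  rewrite -mulr_sumr mulf_eq0 (negPf (fact_neq0 _ _)) /= -rmorph_sum.
  by rewrite (inj_eq (@complexI R) _ 0) => /eqP.
pose y := 1 + \sum_j `|m j|.
have ym i : 0 < y - m i.
  rewrite subr_gt0 /y (bigD1 i) //= addrCA.
  apply: le_lt_trans (ler_norm _) _; rewrite ltrDl.
  by rewrite ltr_pwDl // sumr_ge0.
pose Q := \prod_j (y - m j).
have Q0 : Q != 0 by apply/prodf_neq0 => j _; rewrite gt_eqF.
have div0 : \sum_i w i / (y - m i) = 0.
  apply: (mulfI Q0); rewrite mulr0 -[RHS](prod0 y) mulr_sumr.
  apply: eq_bigr => i _; rewrite /Q (bigD1 i) //=; field.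
  by rewrite gt_eqF.
have sq0 : \sum_i w i ^+ 2 / (y - m i) = 0.
  (* k = y - m_i + w_i for every i. *)
  pose k := y - m ord0 + w ord0.
  have -> : \sum_i w i ^+ 2 / (y - m i) =
      k * (\sum_i w i / (y - m i)) - \sum_i w i.
    rewrite mulr_sumr -sumrB; apply: eq_bigr => i _.
    have -> : k = y - m i + w i.
      rewrite /k; have := mw i ord0 => /eqP; rewrite -subr_eq0 => /eqP e.
      by apply/eqP; rewrite -subr_eq0 -e; apply/eqP; ring.
    by field; rewrite gt_eqF.
  by rewrite div0 w0 mulr0 subr0.
move=> i; have /eqP : w i ^+ 2 / (y - m i) = 0.
  rewrite (psumr_eq0P _ sq0) // => j _.
  by rewrite divr_ge0 ?sqr_ge0 // ltW.
by rewrite mulf_eq0 invr_eq0 (gt_eqF (ym i)) orbF sqrf_eq0 => /eqP.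
Qed.

Lemma dis_poly_nonconst : (exists t, dis_poly.[t] != 0) ->
  (forall c, ~ m =1 fun=> c) -> dis_poly^`() != 0.
Proof.
move=> [t1 Dt1] mc; apply/negP => /eqP D'0.
pose c := (\sum_j m j) / n.+1%:R; apply: (mc c) => i; apply/eqP.
have D0 t : dis_poly.[t] != 0.
  have : (size dis_poly <= 1)%N.
    case sD : (size dis_poly) => [|[|k]] //.
    have /eqP := congr1 (fun q : {poly R} => q`_k) D'0.
    rewrite coef_deriv coef0 -mulr_natr mulf_eq0 pnatr_eq0 orbF.
    have -> : dis_poly`_k.+1 = lead_coef dis_poly by rewrite lead_coefE sD.
    by rewrite lead_coef_eq0 -size_poly_eq0 sD.
  by move=> /size1_polyC DE; move: Dt1; rewrite DE !hornerC.
rewrite -subr_eq0; apply/eqP; move: i.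
apply: conv_diff_eq0 => [|i j|t t0].
- by rewrite sumrB sumr_const card_ord -[X in _ - X]mulr_natr divfK ?subrr.
- by ring.
have [L [_ LE]] := dis_poly_dlog t0 (D0 t); apply.
move: LE; rewrite D'0 horner0 => /esym/eqP.
by rewrite mulf_eq0 (negPf (D0 t)) => /eqP.
Qed.

Lemma dis_poly_smono : (exists t, dis_poly.[t] != 0) ->
  (forall c, ~ m =1 fun=> c) ->
  forall s t, 0 <= s -> s < t -> dis_poly.[s] < dis_poly.[t].
Proof. by move=> D0 mc; apply: poly_smono dis_poly_mono (dis_poly_nonconst D0 mc). Qed.

End Monotone.

(** * Entropy, and the link with the given definitions *)

Section Entropy.
Variable R : realType.
Local Notation C := R[i].
Local Notation roots := (@Defs.roots R).
Local Notation normc := (@ComplexField.Normc.normc R).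
Local Notation normcM := (@ComplexField.Normc.normcM R).
Local Notation normc1 := (@ComplexField.Normc.normc1 R).
Implicit Types p r : {poly C}.

Lemma ln_prod (I : finType) (P : pred I) (F : I -> R) : (forall i, P i -> 0 < F i) ->
  0 < \prod_(i | P i) F i /\ ln (\prod_(i | P i) F i) = \sum_(i | P i) ln (F i).
Proof.
move=> F0; apply: (big_ind2 (fun x y => 0 < x /\ ln x = y)) => [|x x' y y'|i Pi].
- by rewrite ln1.
- move=> [x0 <-] [y0 <-]; rewrite mulr_gt0 // lnM //.
by split=> //; exact: F0.
Qed.

Lemma normc_gt0 (z : C) : z != 0 -> 0 < normc z.
Proof.
rewrite -normr_gt0 -[`|z|]/((normc z)%:C).
by rewrite -(rmorph0 (real_complex R)) ltcR.
Qed.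

(** The inner sum is the one in the definition of the entropy, which is therefore
    an increasing function of the discriminant. *)
Lemma ln_Dis p : uniq (roots p) -> 0 <= Dis p ->
  exists2 x : R, 0 < x & Dis p = x%:C /\
    ln x = (\sum_(j < size (roots p)) \sum_(i < j)
      ln (normc ((roots p)`_i - (roots p)`_j))) *+ 2.
Proof.
move=> u D0; exists (normc (Dis p)).
  by apply: normc_gt0; rewrite Dis_neq0.
split; first by rewrite -[LHS]ger0_norm.
have a0 (j : 'I_(size (roots p))) (i : 'I_j) :
    0 < normc ((roots p)`_i - (roots p)`_j).
  apply: normc_gt0; rewrite subr_eq0 nth_uniq ?ltn_eqF //.
  exact: ltn_trans (ltn_ord i) (ltn_ord j).
have in0 (j : 'I_(size (roots p))) :=
  @ln_prod _ xpredT (fun i : 'I_j => normc ((roots p)`_i - (roots p)`_j) ^+ 2)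
   (fun i _ => exprn_gt0 2 (a0 j i)).
have -> : normc (Dis p) = \prod_(j < size (roots p)) \prod_(i < j)
    normc ((roots p)`_i - (roots p)`_j) ^+ 2.
  rewrite /Dis (big_morph _ normcM normc1).
  apply: eq_bigr => j _.
  rewrite (big_morph _ normcM normc1).
  by apply: eq_bigr => i _; rewrite !expr2 ComplexField.Normc.normcM.
have [_ ->] := @ln_prod _ xpredT
  (fun j : 'I_(size (roots p)) =>
     \prod_(i < j) normc ((roots p)`_i - (roots p)`_j) ^+ 2)
  (fun j _ => (in0 j).1).
rewrite -sumrMnl; apply: eq_bigr => j _; rewrite (in0 j).2 -sumrMnl.
by apply: eq_bigr => i _; rewrite lnXn.
Qed.

Lemma entropy_lt p r k : (1 < k)%N -> size (roots p) = k -> size (roots r) = k ->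
  0 <= Dis p -> Dis p < Dis r -> (entropy p < entropy r)%E.
Proof.
move=> k1 sp sr p0 pr; have r0 := le_lt_trans p0 pr.
have ur : uniq (roots r) by rewrite -Dis_neq0 gt_eqF.
rewrite /entropy ur; case: ifP => up; last exact: ltNyr.
have [x x0 [xE lx]] := ln_Dis up p0; have [y y0 [yE ly]] := ln_Dis ur (ltW r0).
rewrite lte_fin sp sr ltr_pM2l ?invr_gt0 ?ltr0n ?bin_gt0 //.
have : ln x < ln y by rewrite ltr_ln // -ltcR -xE -yE.
by rewrite lx ly sp sr ltr_pMn2r.
Qed.

End Entropy.

Section Bridge.
Variable R : realType.
Local Notation C := R[i].
Local Notation roots := (@Defs.roots R).

Lemma conv_atN n (m l : 'I_n.+1 -> R) (t : R) :
  conv_at m l t%:C = conv_at (fun i => - m i) l (- t)%:C.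
Proof.
rewrite /conv_at; congr (_ *: _); apply: eq_bigr => s _; apply: eq_bigr => i _.
by rewrite -!rmorphM mulrNN.
Qed.

Lemma conv_at0 n (m l : 'I_n.+1 -> R) :
  conv_at m l 0 = \prod_i ('X - ((l i)%:C)%:P).
Proof.
set P := RHS; have PE (s : 'S_n.+1) :
    \prod_i ('X - (0 * (m i)%:C + (l (s i))%:C)%:P) = P.
  rewrite /P [RHS](reindex_perm s); apply: eq_bigr => i _.
  by rewrite mul0r add0r.
rewrite /conv_at; under eq_bigr do rewrite PE.
by rewrite sumr_const card_Sn -[P *+ _]scaler_nat scalerA mulVf ?scale1r ?fact_neq0.
Qed.

(** [roots] lists the roots of the dilation in an unspecified order, which differs
    from that of the t m_i by a permutation g; the sum over all permutations
    absorbs g. *)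
Lemma ffconv_conv_at n (m l : 'I_n.+1 -> R) (t : R) (p q : {poly C}) :
    size (roots q) = n.+1 ->
    (forall i : 'I_n.+1, (roots q)`_i = (m i)%:C) ->
    (forall i : 'I_n.+1, (roots p)`_i = (l i)%:C) ->
  ffconv n.+1 (root_dilation t q) p = conv_at m l t%:C.
Proof.
move=> sq qm pl; pose z (i : 'I_n.+1) := t%:C * (m i)%:C.
pose zt := [tuple z i | i < n.+1].
have qt : root_dilation t q = \prod_(w <- zt) ('X - w%:P).
  rewrite /root_dilation (big_nth 0) sq big_mkord big_tuple.
  by apply: eq_bigr => i _; rewrite qm tnth_mktuple.
have : perm_eq (roots (root_dilation t q)) zt.
  apply: prod_XsubC_eq; rewrite -monic_rootsE ?qt //.
  exact: monic_prod_XsubC.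
move=> /tuple_permP[g gE].
have rE (i : 'I_n.+1) : (roots (root_dilation t q))`_i = z (g i).
  by rewrite gE -tnth_nth !tnth_mktuple.
rewrite /ffconv /conv_at; congr (_ *: _).
rewrite (reindex_inj (mulgI g)) /=; apply: eq_bigr => s _.
rewrite [RHS](reindex_perm g); apply: eq_bigr => i _.
by rewrite rE pl permM.
Qed.

Lemma root_dilation1 (q : {poly C}) : q \is monic -> root_dilation 1 q = q.
Proof.
move=> mq; rewrite [RHS](monic_rootsE mq) /root_dilation.
by apply: eq_bigr => z _; rewrite mul1r.
Qed.

Lemma real_rooted_nth (p : {poly C}) k : p \is monic -> size p = k.+1 ->
  real_rooted p -> forall i, (i < k)%N -> (roots p)`_i = (complex.Re (roots p)`_i)%:C.
Proof.
move=> mp sp pR i ik; rewrite RRe_real // pR // -mem_roots //.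
by rewrite mem_nth // (size_roots mp sp).
Qed.

Lemma Dis_size1 (p : {poly C}) : p \is monic -> size p = 1 -> Dis p = 1.
Proof. by move=> mp sp; rewrite /Dis (size_roots mp sp) big_ord0. Qed.

Lemma ffconv0 (p q : {poly C}) : ffconv 0 p q = 1.
Proof.
rewrite /ffconv (eq_bigr (fun=> 1)) => [|s _]; last by rewrite big_ord0.
by rewrite sumr_const card_Sn fact0 invr1 scale1r.
Qed.

End Bridge.

Theorem theorem1p4 (R : realType) (d : nat) (p q : {poly R[i]})
  (p_monic : p \is monic) (p_size : size p = d.+1) (p_real : real_rooted p)
  (q_monic : q \is monic) (q_size : size q = d.+1) (q_real : real_rooted q) :
  let D := fun t : R => Dis (ffconv d (root_dilation t q) p) in
  [/\ forall s t : R, s <= t -> t < 0 -> D t <= D s,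
      forall s t : R, 0 < s -> s <= t -> D s <= D t,
      forall t : R, D 0 <= D t
    & (forall c : R, q <> ('X - (c%:C)%:P) ^+ d) ->
      (exists t : R, D t <> 0) ->
      [/\ exists2 e : R, 0 < e &
            forall s t : R, - e < s -> s < t -> t < 0 -> D t < D s,
          exists2 e : R, 0 < e &
            forall s t : R, 0 < s -> s < t -> t < e -> D s < D t,
          Dis p < Dis (ffconv d q p)
        & (entropy p < entropy (ffconv d q p))%E]].
Proof.
case: d => [|n] in p_size q_size * => D.
  have DE t : D t = 1 by rewrite /D ffconv0 Dis_size1 ?monic1 ?size_poly1.
  split=> [s t _ _|s t _ _|t|qc]; rewrite ?DE ?lexx //.
  case: (qc 0); rewrite expr0 (size1_polyC (eq_leq q_size)).
  have := monicP q_monic; rewrite lead_coefE q_size /= => ->.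
  by rewrite polyC1.
pose l (i : 'I_n.+1) := complex.Re (Defs.roots p)`_i.
pose m (i : 'I_n.+1) := complex.Re (Defs.roots q)`_i.
have pl (i : 'I_n.+1) : (Defs.roots p)`_i = (l i)%:C.
  exact: real_rooted_nth p_monic p_size p_real _ (ltn_ord i).
have qm (i : 'I_n.+1) : (Defs.roots q)`_i = (m i)%:C.
  exact: real_rooted_nth q_monic q_size q_real _ (ltn_ord i).
have convE t := ffconv_conv_at t (size_roots q_monic q_size) qm pl.
have DE t : D t = ((dis_poly m l).[t])%:C by rewrite /D convE Dis_conv_at.
pose m' i := - m i.
have DNE t : D t = ((dis_poly m' l).[- t])%:C.
  by rewrite /D convE conv_atN Dis_conv_at.
have D0 : Dis p = D 0.
  rewrite /D convE conv_at0 {1}(monic_rootsE_ord p_monic p_size).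
  by congr Dis; apply: eq_bigr => i _; rewrite pl.
have D1 : Dis (ffconv n.+1 q p) = D 1 by rewrite /D root_dilation1.
split.
- move=> s t st t0; rewrite !DNE lecR dis_poly_mono ?lerN2 //.
  by rewrite oppr_ge0 ltW.
- by move=> s t s0 st; rewrite !DE lecR dis_poly_mono // ltW.
- move=> t; have [t0|t0] := leP 0 t; first by rewrite !DE lecR dis_poly_mono.
  by rewrite !DNE oppr0 lecR dis_poly_mono // oppr_ge0 ltW.
move=> qc [t0 Dt0].
have mc c : ~ m =1 fun=> c.
  move=> mcE; apply: (qc c); rewrite (monic_rootsE_ord q_monic q_size).
  rewrite -[X in _ ^+ X]card_ord -prodr_const; apply: eq_bigr => i _.
  by rewrite qm mcE.
(* In degree 1 all roots of q coincide; in higher degree the entropy has a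
   positive normalization factor. *)
have n0 : (0 < n)%N.
  rewrite lt0n; apply/eqP => n0; apply: (mc (m ord0)) => i; congr m.
  by apply: val_inj; case: i => [[|i]] //= ; rewrite n0.
have mc' c : ~ m' =1 fun=> c.
  by move=> e; apply: (mc (- c)) => i; rewrite -(e i) opprK.
have ex : exists t, (dis_poly m l).[t] != 0.
  by exists t0; apply/eqP => e; apply: Dt0; rewrite DE e.
have ex' : exists t, (dis_poly m' l).[t] != 0.
  by exists (- t0); apply/eqP => e; apply: Dt0; rewrite DNE e.
have lt01 : Dis p < Dis (ffconv n.+1 q p).
  by rewrite D0 D1 !DE ltcR dis_poly_smono.
split=> //.
- exists 1 => // s t _ st t_lt0; rewrite !DNE ltcR dis_poly_smono ?ltrN2 //.
  by rewrite oppr_ge0 ltW.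
- by exists 1 => // s t s0 st _; rewrite !DE ltcR dis_poly_smono // ltW.
apply: (@entropy_lt _ _ _ n.+1) => //.
- exact: size_roots p_monic p_size.
- rewrite -(root_dilation1 q_monic) convE.
  by have [? ?] := conv_at_monic m l 1%:C; rewrite (size_roots (k := n.+1)).
by rewrite D0 DE ler0c dis_poly_ge0.
Qed.
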